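(* The class of monoholed graphs is $U_4$-asymptotic minor-free, i.e., there is a positive integer $K$ such that no monoholed graph contains $U_4$ as a $K$-fat minor. Consequently, there is a constant $c$ such that every connected monoholed graph $G$ satisfies $\mathrm{sipc}(G)\le c$.
   Context: Graphs are finite, simple, undirected, unweighted. A hole is an induced cycle of length at least $4$. A graph is monoholed if there is an integer $\ell$ such that every hole of the graph has length exactly $\ell$. $U_4$ is the graph obtained from a path on $4$ vertices by adding a vertex adjacent to all vertices of the path. For a positive integer $K$ and graph $H$, a $K$-fat minor model of $H$ in $G$ is a collection of connected subgraphs $B_v$ ($v\in V(H)$) and $P_e$ ($e\in E(H)$) of $G$ such that $V(B_v)\cap V(P_e)\ne\emptyset$ whenever $v$ is an end-vertex of $e$, and every other pair of distinct members $X,Y$ satisfies $\mathrm{dist}_G(X,Y)\ge K$ (minimum distance between their vertices); $G$ contains $H$ as a $K$-fat minor if such a model exists. An isometric path is a shortest path; it is $v$-rooted if $v$ is an end-vertex. For connected $G$, $\mathrm{ipc}_v(G)$ is the minimum $k$ such that the vertices of any isometric path of $G$ can be covered by $k$ many $v$-rooted isometric paths, and $\mathrm{sipc}(G)=\max_{v\in V(G)}\mathrm{ipc}_v(G)$. *)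

(* Defs.v *)
From mathcomp Require Import all_boot.
From mathcomp Require Import boolp.

Set Implicit Arguments.
Unset Strict Implicit.
Unset Printing Implicit Defensive.

Record sgraph := SGraph {
  vertex :> finType;
  edge : rel vertex;
  edge_sym : symmetric edge;
  edge_irr : irreflexive edge
}.

Definition edges (G : sgraph) : {set {set G}} :=
  [set s | [exists x : G, exists y : G, edge x y && (s == [set x; y])]].

(* The path is x :: p, it ends at y, and its length is size p. *)
Definition is_path (G : sgraph) (x : G) (p : seq G) (y : G) : bool :=
  [&& path (@edge G) x p, uniq (x :: p) & last x p == y].

Definition isometric_path (G : sgraph) (x : G) (p : seq G) : Prop :=
  is_path x p (last x p) /\
  forall q : seq G, is_path x q (last x p) -> size p <= size q.

(* dist_G(X, Y) >= K. The distance is infinite when no path joins X to Y. *)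
Definition dist_geq (G : sgraph) (K : nat) (X Y : {set G}) : Prop :=
  forall (x y : G) (p : seq G),
    x \in X -> y \in Y -> is_path x p y -> K <= size p.

Definition connected_graph (G : sgraph) : Prop :=
  0 < #|G| /\ forall x y : G, connect (@edge G) x y.

Definition hole (G : sgraph) (c : seq G) : Prop :=
  [/\ 4 <= size c,
      ucycle (@edge G) c
    & forall x y : G, x \in c -> y \in c -> edge x y ->
        y = next c x \/ x = next c y].

Definition monoholed (G : sgraph) : Prop :=
  exists l : nat, forall c : seq G, hole c -> size c = l.

Record subgraph (G : sgraph) := Subgraph {
  sub_vertices : {set G};
  sub_edge : rel G;
  sub_edge_sym : symmetric sub_edge;
  sub_edgeP : forall x y : G, sub_edge x y ->
    [/\ x \in sub_vertices, y \in sub_vertices & edge x y]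
}.

Definition connected_subgraph (G : sgraph) (X : subgraph G) : Prop :=
  sub_vertices X != set0 /\
  {in sub_vertices X &, forall x y : G, connect (@sub_edge G X) x y}.

(* Members of the model are distinguished by their index; only the values of
   P on edges of H are relevant. *)
Record fat_minor_model (K : nat) (H G : sgraph)
    (B : H -> subgraph G) (P : {set H} -> subgraph G) : Prop := FatMinorModel {
  fm_B_connected : forall v : H, connected_subgraph (B v);
  fm_P_connected : forall e : {set H}, e \in edges H ->
    connected_subgraph (P e);
  fm_incident : forall (v : H) (e : {set H}), e \in edges H -> v \in e ->
    sub_vertices (B v) :&: sub_vertices (P e) != set0;
  fm_BB : forall u v : H, u != v ->
    dist_geq K (sub_vertices (B u)) (sub_vertices (B v));
  fm_PP : forall e f : {set H}, e \in edges H -> f \in edges H -> e != f ->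
    dist_geq K (sub_vertices (P e)) (sub_vertices (P f));
  fm_BP : forall (v : H) (e : {set H}), e \in edges H -> v \notin e ->
    dist_geq K (sub_vertices (B v)) (sub_vertices (P e))
}.

Definition fat_minor (K : nat) (H G : sgraph) : Prop :=
  exists (B : H -> subgraph G) (P : {set H} -> subgraph G),
    fat_minor_model K B P.

Definition asymptotic_minor_free (H : sgraph) (C : sgraph -> Prop) : Prop :=
  exists K : nat, 0 < K /\ forall G : sgraph, C G -> ~ fat_minor K H G.

Definition path_rel (n : nat) : rel 'I_n :=
  fun i j => (i.+1 == j :> nat) || (j.+1 == i :> nat).

Fact path_rel_sym n : symmetric (@path_rel n).
Proof. by move=> i j; rewrite /path_rel orbC. Qed.

Fact path_rel_irr n : irreflexive (@path_rel n).
Proof. by move=> i; rewrite /path_rel orbb eqn_leq ltnn. Qed.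

Definition path_graph (n : nat) : sgraph :=
  SGraph (@path_rel_sym n) (@path_rel_irr n).

Definition cone_rel (G : sgraph) : rel (option G) := fun a b =>
  match a, b with
  | Some x, Some y => edge x y
  | None, None => false
  | _, _ => true
  end.

Fact cone_rel_sym G : symmetric (@cone_rel G).
Proof. by case=> [x|] [y|] //=; exact: edge_sym. Qed.

Fact cone_rel_irr G : irreflexive (@cone_rel G).
Proof. by case=> [x|] //=; exact: edge_irr. Qed.

Definition cone (G : sgraph) : sgraph :=
  SGraph (@cone_rel_sym G) (@cone_rel_irr G).

Definition U4 : sgraph := cone (path_graph 4).

(* Repetitions among the k paths are allowed. *)
Definition ipc_cover (G : sgraph) (v : G) (k : nat) : Prop :=
  forall (x : G) (p : seq G), isometric_path x p ->
    exists (a : 'I_k -> G) (q : 'I_k -> seq G),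
      (forall i : 'I_k, isometric_path (a i) (q i) /\
         (v = a i \/ v = last (a i) (q i))) /\
      forall y : G, y \in x :: p -> exists i : 'I_k, y \in a i :: q i.

Lemma exists_isometric_path (G : sgraph) (x y : G) :
  connect (@edge G) x y ->
  exists p : seq G, isometric_path x p /\ last x p = y.
Proof.
move=> /connectP[p0 /shortenP[p pP Up _] def_y].
have exn : exists n, [exists t : n.-tuple G, is_path x t y].
  by exists (size p); apply/existsP; exists (in_tuple p); rewrite /is_path pP Up def_y /=.
case: (ex_minnP exn) => n /existsP[t xty] n_min.
have lt : last x t = y by case/and3P: xty => _ _ /eqP.
exists t; split=> //; split; rewrite lt // => q xqy.
by rewrite size_tuple n_min //; apply/existsP; exists (in_tuple q).
Qed.

Lemma ipc_exists (G : sgraph) (v : G) :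
  connected_graph G -> exists k : nat, `[< ipc_cover v k >].
Proof.
move=> [_ cG]; exists #|G|; apply/asboolP=> x p _.
have /fin_all_exists[q qP] (i : 'I_#|G|) :
    exists q, isometric_path v q /\ last v q = enum_val i.
  exact: exists_isometric_path.
exists (fun=> v), q; split=> [i|y _]; first by split; [case: (qP i) | left].
exists (enum_rank y); have [_ eq_y] := qP (enum_rank y).
by rewrite -[X in X \in _](enum_rankK y) -eq_y mem_last.
Qed.

Definition ipc (G : sgraph) (Gc : connected_graph G) (v : G) : nat :=
  ex_minn (ipc_exists v Gc).

Definition sipc (G : sgraph) (Gc : connected_graph G) : nat :=
  \max_(v : G) ipc Gc v.

(* Main.v *)
(** The idea behind the first half is that a graph all of whose cycles have
    equal length [l] is, up to bounded errors, a cycle or a bundle of equally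
    long parallel paths. Take a hole [C] through an end triangle of a fat model
    of the fan, and an induced path [Q] outside it joining two distant places of
    [C]. The two holes that [Q] forms with [C] have length [l], so the ends of
    [Q] are almost antipodal on [C]. A further path [t] from the middle of [Q]
    to the neighbourhood of one of its ends gives a second path from [C] to [C],
    hence again antipodal ends; so [t] returns to [C] where [Q] does, and the
    cycle formed by [t] and the end of [Q] is too short.

    For the second half, let [u] be a geodesic and [f i] the distance from the
    root [v] to [u i]. The functions [i - f i] and [i + f i] are nondecreasing.
    On an interval where one of them grows by less than [W], fewer than [W]
    maximal runs have constant value, and each run lies on one [v]-rooted
    geodesic. So if [u] needs many rooted paths, there is a long chain of
    indices along which both functions grow by [W]. Geodesics from [v] to
    alternate members of the chain first come close to [u] at points that are
    far apart on [u], and these truncated geodesics together with segments of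
    [u] form a fat fan. *)

Require Import Defs.
From mathcomp Require Import all_boot zify.
From mathcomp Require Import boolp.

Set Implicit Arguments.
Unset Strict Implicit.
Unset Printing Implicit Defensive.

(* [size] may carry two convertible forms of the vertex type, which [lia]
   would treat as distinct atoms. *)
Ltac slia :=
  repeat match goal with
  | |- context [@size (Equality.sort (fintype_Finite__to__eqtype_Equality ?V)) ?s] =>
    change (@size (Equality.sort (fintype_Finite__to__eqtype_Equality V)) s)
      with (@size (Finite.sort V) s)
  | H : context
      [@size (Equality.sort (fintype_Finite__to__eqtype_Equality ?V)) ?s] |- _ =>
    change (@size (Equality.sort (fintype_Finite__to__eqtype_Equality V)) s)
      with (@size (Finite.sort V) s) in H
  end; lia.

(* Boolean hypotheses about membership or adjacency make [lia] very slow. *)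
Ltac clia :=
  repeat match goal with H : ?T |- _ => lazymatch T with
    | is_true (leq _ _) => fail
    | is_true (andb (leq _ _) (leq _ _)) => fail
    | @eq nat _ _ => fail
    | _ => clear H
    end end; slia.

(** * Induced paths and holes as lists *)

Section Lists.
Variable T : eqType.
Implicit Types (s : seq T) (d x : T).

Lemma mem_head_default d s : 0 < size s -> head d s \in s.
Proof. by case: s => //= x s _; rewrite mem_head. Qed.

Lemma mem_last_default d s : 0 < size s -> last d s \in s.
Proof. by case: s => //= x s _; rewrite mem_last. Qed.

Lemma index_eq_last d s x : uniq s -> x \in s ->
  (x == last d s) = ((index x s).+1 == size s).
Proof.
case/lastP: s => // s y; rewrite rcons_uniq last_rcons mem_rcons inE size_rcons.
rewrite -cats1 index_cat /= => /andP[yNs _]; case: (eqVneq x y) => [->|xNy].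
  by rewrite (negPf yNs) addn0 eqxx.
by move=> /= xs; rewrite xs eqSS; have := xs; rewrite -index_mem; lia.
Qed.

Lemma index_eq_head d s x : x \in s -> (x == head d s) = (index x s == 0).
Proof. by case: s => //= y s _; rewrite eq_sym; case: (y == x). Qed.

Lemma head_cat_nonempty d s t : 0 < size s -> head d (s ++ t) = head d s.
Proof. by case: s. Qed.

Lemma last_cat_nonempty d s t : 0 < size t -> last d (s ++ t) = last d t.
Proof. by case/lastP: t => // t x _; rewrite -rcons_cat !last_rcons. Qed.

Lemma head_rev d s : head d (rev s) = last d s.
Proof. by case/lastP: s => // s x; rewrite rev_rcons last_rcons. Qed.

Lemma last_rev d s : last d (rev s) = head d s.
Proof. by case: s => // x s; rewrite rev_cons last_rcons. Qed.

(** Cut at the first and at the last element satisfying [P]; elements strictly inside [s2] may fail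
    it. With adjacency to a vertex as [P], [s2] is the shortest stretch of a path or hole containing
    all neighbours of that vertex. *)
Lemma hull d (P : pred T) s : has P s ->
  exists s1 s2 s3, [/\ s = s1 ++ s2 ++ s3, 0 < size s2,
    P (head d s2) /\ P (last d s2), {in s1, forall x, ~~ P x} &
    {in s3, forall x, ~~ P x}].
Proof.
case/split_find=> x s1 t Px s1P.
have [tP|tP] := boolP (has P (rev t)); last first.
  exists s1, [:: x], t; split=> // [|y ys1|y yt]; first by rewrite -cats1 -catA.
    by apply: contra s1P => Py; apply/hasP; exists y.
  by apply: contra tP => Py; apply/hasP; exists y; rewrite ?mem_rev.
move: (revK t); case/split_find: tP => y r1 r2 Py r1P.
rewrite rev_cat rev_rcons => <-.
exists s1, (x :: rcons (rev r2) y), (rev r1).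
split=> //= [||z zs1|z]; rewrite ?last_rcons ?mem_rev //.
- by rewrite -!cats1 -!catA.
- by apply: contra s1P => Pz; apply/hasP; exists z.
- by move=> zr1; apply: contra r1P => Pz; apply/hasP; exists z.
Qed.

Lemma split_index2 s x y : x \in s -> y \in s -> index x s < index y s ->
  exists a b c, [/\ s = a ++ x :: b ++ y :: c, index x s = size a &
    index y s = size a + (size b).+1].
Proof.
move=> xs ys ltxy.
exists (take (index x s) s), (drop (index x s).+1 (take (index y s) s)),
  (drop (index y s).+1 s).
have lty : index y s < size s by rewrite index_mem.
split; last 2 first.
- by rewrite size_takel; lia.
- by rewrite size_drop !size_takel; lia.
have Ey : drop (index y s) s = y :: drop (index y s).+1 s.
  by rewrite (drop_nth x) // nth_index.
have Ex : drop (index x s) (take (index y s) s) =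
    x :: drop (index x s).+1 (take (index y s) s).
  by rewrite (drop_nth x) ?size_takel 1?nth_take ?nth_index // ltnW.
rewrite -Ey -cat_cons -Ex catA -[take (index x s) s](take_takel _ (ltnW ltxy)).
by rewrite !cat_take_drop.
Qed.

End Lists.

Section InducedPaths.
Variables (G : sgraph) (d : G).
Implicit Types (s t c : seq G) (x y z : G).

(** Adjacency is expressed by positions, so that checking whether a concatenation is induced becomes
    linear arithmetic on indices. The list includes the first vertex of the path and may be
    empty. *)
Definition ipath s := uniq s /\ {in s &, forall x y,
  edge x y = ((index x s).+1 == index y s) || ((index y s).+1 == index x s)}.

Definition icycle s := uniq s /\ {in s &, forall x y,
  edge x y = [|| (index x s).+1 == index y s, (index y s).+1 == index x s,
    (index x s == 0) && ((index y s).+1 == size s) |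
    (index y s == 0) && ((index x s).+1 == size s)]}.

Lemma index_next s x : uniq s -> x \in s ->
  index (next s x) s = if (index x s).+1 == size s then 0 else (index x s).+1.
Proof.
case: s => [//|a s] Us xs; rewrite next_nth xs.
have := xs; rewrite -index_mem.
move: (index x (a :: s)) => i lti; have [eqi|neqi] := eqVneq.
  by rewrite nth_default /= ?eqxx //; move: eqi => /= [->].
have lti' : i.+1 < size (a :: s) by rewrite ltn_neqAle neqi.
exact: (@index_uniq _ a _ (a :: s) lti' Us).
Qed.

Lemma eq_next s x y : uniq s -> x \in s -> y \in s ->
  (y == next s x) = ((index x s).+1 == index y s) ||
                    ((index y s == 0) && ((index x s).+1 == size s)).
Proof.
move=> Us xs ys; have := xs; have := ys; rewrite -!index_mem => lty ltx.
have -> : (y == next s x) = (index y s == index (next s x) s).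
  by apply/eqP/eqP => [->//|]; apply: index_inj => //; rewrite ?mem_next.
by rewrite index_next //; case: ifP; slia.
Qed.

Lemma holeE s : hole s <-> 4 <= size s /\ icycle s.
Proof.
split=> [[s4 /andP[cs Us] h]|[s4 [Us h]]]; split=> //.
- split=> // x y xs ys; have := eq_next Us xs ys; have := eq_next Us ys xs.
  move=> Eyx Exy; apply/idP/idP.
    by case/(h _ _ xs ys) => /eqP; rewrite ?Exy ?Eyx => /orP[->|->]; rewrite ?orbT.
  have : (y == next s x) -> edge x y by move/eqP->; apply: next_cycle.
  have : (x == next s y) -> edge y x by move/eqP->; apply: next_cycle.
  rewrite Exy Eyx (edge_sym x y); move=> h1 h2.
  by case/or4P=> hh; [apply: h2|apply: h1|apply: h1|apply: h2]; rewrite hh ?orbT.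
- apply/andP; split=> //; apply: cycle_from_next => // x xs.
  rewrite h ?mem_next //; have := eq_next Us xs (y := next s x).
  rewrite mem_next eqxx => /(_ xs)/esym/orP[->//|->]; by rewrite !orbT.
- move=> x y xs ys; rewrite h // => H; have := eq_next Us xs ys.
  have := eq_next Us ys xs => /esym Eyx /esym Exy.
  have [/eqP|H1] := boolP (y == next s x); first by left.
  right; apply/eqP; rewrite -Eyx; move: H; rewrite (negPf H1) in Exy.
  move/norP: (negbT Exy) => [/negPf-> /negPf->]; rewrite orbF /=.
  by case: (_.+1 == _).
Qed.

Lemma hole_uniq s : hole s -> uniq s.
Proof. by case=> _ /andP[]. Qed.

Lemma hole_catC s t : hole (s ++ t) -> hole (t ++ s).
Proof.
case=> [s4 /andP[cs Us] h]; rewrite -(rot_size_cat s t); split.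
- by rewrite size_rot.
- by rewrite /ucycle rot_cycle rot_uniq cs Us.
- by move=> x y; rewrite !mem_rot !next_rot //; apply: h.
Qed.

Lemma hole_rev s : hole s -> hole (rev s).
Proof.
case=> [s4 /andP[cs Us] h]; split; first by rewrite size_rev.
  rewrite /ucycle rev_cycle rev_uniq Us andbT.
  by rewrite (@eq_cycle _ _ (@edge G)) // => x y; rewrite edge_sym.
move=> x y; rewrite !mem_rev => xs ys; rewrite !next_rev // => /(h _ _ xs ys).
by case=> ->; rewrite prev_next //; [right|left].
Qed.

(** A vertex outside [s] excludes the wrap-around adjacency: [s] then misses the last position of
    the cycle. *)
Lemma ipath_hole s t : hole (s ++ t) -> 0 < size t -> ipath s.
Proof.
case/holeE=> _ [Ust h] t0; move: (Ust); rewrite cat_uniq => /andP[Us _].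
split=> // x y xs ys; have := xs; have := ys; rewrite -!index_mem => lty ltx.
rewrite h ?mem_cat ?xs ?ys // !index_cat xs ys size_cat; slia.
Qed.

Lemma ipath_infix s t r : ipath (s ++ t ++ r) -> ipath t.
Proof.
case=> U h; move: (U); rewrite !cat_uniq has_cat negb_or.
case/and4P => _ /andP[dis _] Ut _; split=> // x y xt yt.
have xNs : x \in s = false by apply: contraNF dis => xs; apply/hasP; exists x.
have yNs : y \in s = false by apply: contraNF dis => ys; apply/hasP; exists y.
rewrite h ?mem_cat ?xt ?yt ?orbT // !index_cat xNs yNs xt yt; slia.
Qed.

Lemma ipath_rev s : ipath s -> ipath (rev s).
Proof.
case=> U h; split=> [|x y]; rewrite ?rev_uniq // !mem_rev => xs ys.
have ind z : z \in s -> index z (rev s) = size s - (index z s).+1.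
  move=> zs; have := zs; rewrite -index_mem => ltz.
  have lt : size s - (index z s).+1 < size (rev s) by rewrite size_rev; slia.
  have {1}-> : z = nth z (rev s) (size s - (index z s).+1).
    rewrite nth_rev ?size_rev in lt *; last by slia.
    have -> : size s - (size s - (index z s).+1).+1 = index z s by slia.
    by rewrite nth_index.
  by rewrite index_uniq ?rev_uniq.
have := xs; have := ys; rewrite -!index_mem => lty ltx.
rewrite h // !ind //; slia.
Qed.

Definition disj s t := {in s, forall x, x \notin t}.

Lemma uniq_disj s t : uniq s -> uniq t -> disj s t -> uniq (s ++ t).
Proof.
move=> Us Ut dst; rewrite cat_uniq Us Ut andbT /=.
by apply/hasPn => x xt; apply/negP => /dst; rewrite xt.
Qed.

Lemma ipath_cat s t : ipath s -> ipath t -> disj s t ->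
  {in s & t, forall x y, edge x y = (x == last d s) && (y == head d t)} ->
  ipath (s ++ t).
Proof.
move=> [Us hs] [Ut ht] dst hst; split=> [|x y]; first exact: uniq_disj.
rewrite !mem_cat; wlog: x y / (x \in s) || (y \in t).
  move=> W; have [xs|xNs] /= := boolP (x \in s) => [_|xt].
    by move=> yst; apply: W; rewrite ?xs.
  have [yt|yNt] := boolP (y \in t) => [_|/orP[ys|//]].
    by apply: W; rewrite ?xt ?yt ?orbT.
  by rewrite edge_sym orbC W ?ys ?xt ?orbT.
have T z : z \in t -> z \in s = false by move=> zt; apply: contraTF zt => /dst.
have [xs _ _|xNs /= yt xt _] := boolP (x \in s); last first.
  rewrite ht // !index_cat !T //; slia.
have [ys _|yNs /= yt] := boolP (y \in s).
  by rewrite hs // !index_cat xs ys.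
rewrite hst // index_eq_last // index_eq_head // !index_cat xs (negPf yNs).
have := xs; have := yt; rewrite -!index_mem; slia.
Qed.

Lemma hole_cat s t : ipath s -> ipath t -> disj s t -> 4 <= size s + size t ->
    0 < size s -> 0 < size t ->
  {in s & t, forall x y, edge x y =
     (x == last d s) && (y == head d t) || (x == head d s) && (y == last d t)} ->
  hole (s ++ t).
Proof.
move=> [Us hs] [Ut ht] dst st4 s0 t0 hst; apply/holeE; rewrite size_cat.
split=> //; split=> [|x y]; first exact: uniq_disj.
rewrite !mem_cat size_cat; wlog: x y / (x \in s) || (y \in t).
  move=> W; have [xs|xNs] /= := boolP (x \in s) => [_|xt].
    by move=> yst; apply: W; rewrite ?xs.
  have [yt|yNt] := boolP (y \in t) => [_|/orP[ys|//]].
    by apply: W; rewrite ?xt ?yt ?orbT.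
  by rewrite edge_sym W ?ys ?xt ?orbT //; slia.
have T z : z \in t -> z \in s = false by move=> zt; apply: contraTF zt => /dst.
have [xs _ _|xNs /= yt xt _] := boolP (x \in s); last first.
  rewrite ht // !index_cat !T //; slia.
have [ys _|yNs /= yt] := boolP (y \in s).
  rewrite hs // !index_cat xs ys; have := xs; have := ys.
  by rewrite -!index_mem; slia.
rewrite hst // !index_eq_last // !index_eq_head // !index_cat xs (negPf yNs).
have := xs; have := yt; rewrite -!index_mem; slia.
Qed.

Lemma two_ipaths_hole s t : ipath s -> ipath t -> disj s t ->
    4 <= size s + size t -> 0 < size s -> 0 < size t ->
  {in s & t, forall x y, edge x y =
     (x == head d s) && (y == head d t) || (x == last d s) && (y == last d t)} ->
  hole (s ++ rev t).
Proof.
move=> is_ it dst st4 s0 t0 hst; apply: hole_cat; rewrite ?size_rev //.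
- exact: ipath_rev.
- by move=> x xs; rewrite mem_rev; apply: dst.
- by move=> x y xs; rewrite mem_rev head_rev last_rev orbC; apply: hst.
Qed.

Lemma ipath_nbr s x : ipath s -> 2 <= size s -> x \in s ->
  exists2 y, y \in s & edge x y.
Proof.
move=> [U h] s2 xs; have := xs; rewrite -index_mem => ltx.
case: (posnP (index x s)) => [x0|xpos].
  exists (nth d s 1); first by rewrite mem_nth.
  by rewrite h ?mem_nth // x0 index_uniq.
exists (nth d s (index x s).-1); first by rewrite mem_nth //; slia.
by rewrite h ?mem_nth ?index_uniq //; slia.
Qed.

End InducedPaths.
(** * Thetas in graphs all of whose holes have the same length *)

Section Monoholed.
Variables (G : sgraph) (d : G) (l : nat).
Hypothesis holes_l : forall c : seq G, hole c -> size c = l.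
Implicit Types (s t c : seq G) (x y z u v : G).

Lemma ends_hole s t : ipath s -> ipath t -> disj s t ->
    4 <= size s + size t -> 0 < size s -> 0 < size t ->
    edge (head d s) (head d t) -> edge (last d s) (last d t) ->
  {in s & t, forall x y, edge x y ->
     x = head d s /\ y = head d t \/ x = last d s /\ y = last d t} ->
  hole (s ++ rev t).
Proof.
move=> ps pt dst st4 s0 t0 eh el hst.
apply: (two_ipaths_hole (d := d)) => // x y xs yt; apply/idP/idP.
  by case/(hst _ _ xs yt) => -[-> ->]; rewrite !eqxx ?orbT.
by case/orP=> /andP[/eqP-> /eqP->].
Qed.

Lemma size_cat_rev_hole s t : hole (s ++ rev t) -> size s + size t = l.
Proof. by move/holes_l; rewrite size_cat size_rev. Qed.

(** If [I] has at least three vertices, replacing its interior by [u] gives another hole, of length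
    [size t + 3], so equality of lengths leaves exactly three. If [u] misses the middle one, then
    [u] and [I] form a hole of length 4. *)
Lemma hull_size I t u : hole (I ++ t) -> 0 < size I -> 0 < size t ->
    u \notin I ++ t -> edge u (head d I) -> edge u (last d I) ->
    {in I ++ t, forall x, edge u x -> x \in I} ->
  size I <= 3 /\ (4 < l -> {in I, forall x, edge u x}).
Proof.
move=> hIt I0 t0 uC eh el hu.
have UIt := hole_uniq hIt.
have l_eq : size I + size t = l by rewrite -size_cat holes_l.
have ds s r q : I ++ t = s ++ r ++ q -> disj r [:: u].
  move=> E x xr; rewrite inE; apply: contraNneq uC => <-.
  by rewrite E !mem_cat xr orbT.
have [I2|I3] := leqP (size I) 2.
  split=> [|_ x]; first exact: leq_trans I2 _.
  case: (I) eh el I2 => [|a [|b [|? ?]]] //= ea eb _; rewrite !inE.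
    by move/eqP->.
  by case/orP=> /eqP->.
have sI3 : size I <= 3.
  pose I' := behead (belast (head d I) (behead I)).
  have EI : I = head d I :: rcons I' (last d I).
    rewrite /I'; case: (I) I3 => [|a [|b I'']] //= _.
    by congr cons; apply: lastI.
  have hI' : hole ((last d I :: rcons t (head d I)) ++ I').
    have := hIt; rewrite {1}EI -cats1 -cat1s -!catA => /hole_catC.
    by rewrite -!catA => /hole_catC; rewrite -cats1.
  have I'0 : 0 < size I'.
    by move: I3; rewrite {1}EI /= size_rcons; clia.
  have pA := ipath_hole hI' I'0.
  have Ein x : x \in last d I :: rcons t (head d I) -> x \in I ++ t.
    rewrite inE mem_rcons inE mem_cat.
    case/or3P=> [/eqP->|/eqP->|->]; rewrite ?orbT // ?mem_last_default //.
    by rewrite mem_head_default.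
  have : size (last d I :: rcons t (head d I)) + size [:: u] = l.
    apply/size_cat_rev_hole/ends_hole => //=; rewrite
      ?size_rcons ?last_rcons ?(edge_sym _ u) //.
    - by split=> // x y; rewrite !inE => /eqP-> /eqP->; rewrite edge_irr /= eqxx.
    - by move=> x xA; rewrite inE; apply: contraNneq uC => <-; apply: Ein.
    - by clia.
    - move=> x y xA; rewrite inE => /eqP->; rewrite edge_sym => ux.
      have xI := hu _ (Ein _ xA) ux; move: xA; rewrite inE mem_rcons inE.
      case/or3P=> [/eqP->|/eqP->|xt]; [by left|by right|].
      by move: UIt; rewrite cat_uniq => /and3P[_ /hasPn/(_ _ xt)/negP].
  by rewrite /= size_rcons; clia.
split=> // l4 x; case EI: (I) I3 sI3 => [|a [|b [|c [|? ?]]]] //= _ _.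
move: eh el; rewrite EI /= => ua uc; rewrite !inE.
have [ub /or3P[]/eqP->//|nub] := boolP (edge u b).
have pI : ipath I by apply: (ipath_hole hIt).
suff: size I + size [:: u] = l by rewrite EI /=; clia.
rewrite EI; apply/size_cat_rev_hole/ends_hole => //=; rewrite -?EI ?(edge_sym _ u) //.
- by split=> // y z; rewrite !inE => /eqP-> /eqP->; rewrite edge_irr /= eqxx.
- exact: (ds [::] _ t).
- move=> y z yI; rewrite !inE => /eqP->; rewrite edge_sym => uy.
  move: yI uy; rewrite EI !inE.
  by case/or3P=> /eqP-> uy; [left|rewrite uy in nub|right].
Qed.

(* [I1] and [I2] are the hulls, in the cyclic list [c], of the neighbours of the
   two ends of [t]. *)
Definition attached t I1 I2 c :=
  [/\ edge (head d t) (head d I1), edge (head d t) (last d I1),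
      edge (last d t) (head d I2), edge (last d t) (last d I2) &
      {in t & c, forall z x, edge z x ->
        z = head d t /\ x \in I1 \/ z = last d t /\ x \in I2}].

(** The arc runs from the last neighbour of [head d t] in [I1] to the first neighbour of [last d t]
    in [I2]; these two contacts are then the only edges between the arc and [t]. *)
Lemma theta_hole I1 L I2 S t : hole (I1 ++ L ++ I2 ++ S) ->
    0 < size I1 -> 0 < size I2 -> 0 < size S ->
    ipath t -> 2 <= size t -> disj t (I1 ++ L ++ I2 ++ S) ->
    attached t I1 I2 (I1 ++ L ++ I2 ++ S) ->
  hole ((last d I1 :: rcons L (head d I2)) ++ rev t).
Proof.
move=> hC I10 I20 S0 pt t2 dt [e1 e2 e3 e4 cr].
have UC := hole_uniq hC.
pose a := last d I1; pose b := head d I2.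
have [I1' EI1] : exists I1', I1 = rcons I1' a.
  by rewrite /a; case/lastP: (I1) I10 => // s x _; exists s; rewrite last_rcons.
have [I2' EI2] : exists I2', I2 = b :: I2'.
  by rewrite /b; case: (I2) I20 => // x s _; exists s.
have EC : I1 ++ L ++ I2 ++ S = I1' ++ (a :: rcons L b) ++ I2' ++ S.
  by rewrite {1}EI1 {1}EI2 -!cats1 /= -!catA.
have hA : hole ((a :: rcons L b) ++ (I2' ++ S ++ I1')).
  by move: hC; rewrite EC => /hole_catC; rewrite -!catA.
have pA : ipath (a :: rcons L b).
  by apply: (ipath_hole hA); rewrite !size_cat; clia.
have subA x : x \in a :: rcons L b -> x \in I1 ++ L ++ I2 ++ S.
  by rewrite EC !mem_cat => ->; rewrite orbT.
apply: ends_hole => //=; rewrite ?size_rcons ?last_rcons; try clia.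
- by move=> x xA; apply/negP => /dt; rewrite subA.
- by rewrite edge_sym.
- by rewrite edge_sym.
- rewrite -/a -/b => x z xA zt; rewrite edge_sym => /(cr _ _ zt (subA _ xA)).
  have := UC; rewrite EC !cat_uniq => /and3P[_ dis1 /and3P[_ dis2 _]].
  case=> -[-> xI]; [left|right]; split=> //.
  + move: xI; rewrite EI1 mem_rcons inE => /predU1P[//|xI1'].
    by move/hasPn: dis1 => /(_ x); rewrite mem_cat xA => /(_ isT)/negP; case.
  + move: xI; rewrite EI2 inE => /predU1P[//|xI2'].
    by move/hasPn: dis2 => /(_ x); rewrite mem_cat xI2' => /(_ isT)/negP; case.
Qed.

Lemma theta_half I1 L I2 S t : hole (I1 ++ L ++ I2 ++ S) ->
    0 < size I1 -> 0 < size I2 -> 0 < size S ->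
    ipath t -> 2 <= size t -> disj t (I1 ++ L ++ I2 ++ S) ->
    attached t I1 I2 (I1 ++ L ++ I2 ++ S) ->
  size L + size t + 2 = l.
Proof.
move=> hC I10 I20 S0 pt t2 dt att.
have := size_cat_rev_hole (theta_hole hC I10 I20 S0 pt t2 dt att).
by rewrite /= size_rcons; clia.
Qed.

(** Each of the two arcs closes up with [t] to a hole, so [L] and [S] have equal size: the
    attachments of [t] are antipodal. The second arc is handled by rotating the hole and reversing
    [t]. *)
Lemma theta I1 L I2 S t : hole (I1 ++ L ++ I2 ++ S) ->
    0 < size I1 -> 0 < size I2 -> 0 < size L -> 0 < size S ->
    ipath t -> 2 <= size t -> disj t (I1 ++ L ++ I2 ++ S) ->
    attached t I1 I2 (I1 ++ L ++ I2 ++ S) ->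
  [/\ size L + size t + 2 = l, size S + size t + 2 = l,
      size I1 + size L + size I2 + size S = l,
      size I1 <= 3 /\ (4 < l -> {in I1, forall x, edge (head d t) x}) &
      size I2 <= 3 /\ (4 < l -> {in I2, forall x, edge (last d t) x})].
Proof.
move=> hC I10 I20 L0 S0 pt t2 dt att.
have hC' : hole (I2 ++ S ++ I1 ++ L).
  by move: hC; rewrite catA => /hole_catC; rewrite -catA.
have inC x : (x \in I2 ++ S ++ I1 ++ L) = (x \in I1 ++ L ++ I2 ++ S).
  by rewrite [in RHS]catA [in RHS]mem_cat orbC -mem_cat -!catA.
have [e1 e2 e3 e4 cr] := att.
have t0 : 0 < size t by clia.
have Nhl : head d t != last d t.
  case: (pt) => Ut _; rewrite index_eq_last ?mem_head_default //.
  by case: (t) t2 => //= a s; rewrite eqxx; clia.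
split.
- exact: (theta_half hC).
- rewrite -(size_rev t); apply: (theta_half hC') => //; rewrite ?size_rev //.
  + exact: ipath_rev.
  + by move=> x; rewrite mem_rev inC => /dt.
  + rewrite /attached head_rev last_rev; split=> // z x; rewrite mem_rev inC.
    by move=> zt xC /(cr _ _ zt xC) [|] ?; [right|left].
- by rewrite -(holes_l hC) !size_cat; clia.
- apply: (@hull_size I1 (L ++ I2 ++ S)) => //; rewrite ?size_cat; try clia.
    by apply: dt; rewrite mem_head_default.
  move=> x xC /(cr _ _ (mem_head_default d t0) xC) [[]//|[E]].
  by rewrite E eqxx in Nhl.
- apply: (@hull_size I2 (S ++ I1 ++ L)) => //; rewrite ?size_cat; try clia.
    by rewrite inC; apply: dt; rewrite mem_last_default.
  move=> x; rewrite inC => xC /(cr _ _ (mem_last_default d t0) xC) [[E]|[]//].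
  by rewrite E eqxx in Nhl.
Qed.

(* [t] joins the middle [J] of [Q = X ++ J ++ Z] to the end of [Q] in [I2]. If
   [t] returns to the hole, the theta formed by the hole and [X ++ J ++ t] shows
   that it does so where [Q] does, so that [Z] and [t] close up to a hole, which
   is too short. If [t] returns to [Z] only, the theta formed by [t] and the
   hole made of [Q] and [L] has ends which are not antipodal. *)
Lemma ear_near_end I1 L I2 S X J Z t :
    hole (I1 ++ L ++ I2 ++ S) ->
    0 < size I1 -> 0 < size I2 -> 0 < size L -> 0 < size S ->
    ipath (X ++ J ++ Z) -> disj (X ++ J ++ Z) (I1 ++ L ++ I2 ++ S) ->
    attached (X ++ J ++ Z) I1 I2 (I1 ++ L ++ I2 ++ S) ->
    20 <= size X -> 20 <= size Z -> 0 < size J ->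
    ipath t -> 2 <= size t ->
    disj t (I1 ++ L ++ I2 ++ S) -> disj t (X ++ J ++ Z) ->
    edge (head d t) (head d J) -> edge (head d t) (last d J) ->
    {in t & X ++ J ++ Z, forall z x, edge z x ->
       z = head d t /\ x \in J \/ z = last d t /\ x \in Z} ->
    {in t & I1 ++ L ++ I2 ++ S, forall z x, edge z x ->
       z = last d t /\ x \in L ++ I2 ++ S} ->
    ~~ edge (last d t) (head d Z) -> ~~ edge (last d t) (head d L) ->
    ~~ edge (last d t) (last d S) ->
  ~~ has (edge (last d t)) (Z ++ L ++ I2 ++ S).
Proof.
move=> hC I10 I20 L0 S0 pQ dQ attQ X20 Z20 J0 pt t2 dtC dtQ ehJ elJ tQ tC.
set v := last d t => nvZ nvL nvS; set C := I1 ++ L ++ I2 ++ S in hC dQ attQ dtC tC *.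
set Q := X ++ J ++ Z in pQ dQ attQ dtQ tQ *.
have t0 : 0 < size t by clia.
have Q0 : 0 < size Q by rewrite /Q size_cat; clia.
have [UQ _] := pQ.
have dXJ x : x \in X -> x \in J = false.
  move: UQ; rewrite /Q !cat_uniq has_cat negb_or => /and3P[_ /andP[/hasPn h _] _].
  by move=> xX; apply: contraTF xX => /h.
have dXZ x : x \in X -> x \in Z = false.
  move: UQ; rewrite /Q !cat_uniq has_cat negb_or => /and3P[_ /andP[_ /hasPn h] _].
  by move=> xX; apply: contraTF xX => /h.
have dJZ x : x \in J -> x \in Z = false.
  move: UQ; rewrite /Q !cat_uniq => /and3P[_ _ /and3P[_ /hasPn h _]].
  by move=> xX; apply: contraTF xX => /h.
have hdQ : head d Q = head d X by rewrite /Q head_cat_nonempty //; clia.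
have lsQ : last d Q = last d Z.
  by rewrite /Q catA last_cat_nonempty //; clia.
have hdX : head d X \in X by rewrite mem_head_default //; clia.
have lsZ : last d Z \in Z by rewrite mem_last_default //; clia.
have hdJ : head d J \in J by rewrite mem_head_default.
have lsJ : last d J \in J by rewrite mem_last_default.
have [] := theta hC I10 I20 L0 S0 pQ _ dQ attQ; first by rewrite /Q size_cat; clia.
rewrite {1 2}/Q !size_cat => lenL lenS lenC [I13 _] [I23 I2all].
have l4 : 4 < l by clia.
have [q1 q2 q3 q4 crQ] := attQ.
have [J1 EJ1] : exists J1, J = head d J :: J1.
  by case: (J) J0 => // a s _; exists s.
have [J2 EJ2] : exists J2, J = rcons J2 (last d J).
  by case/lastP: (J) J0 => // s a _; exists s; rewrite last_rcons.
(* If [v] has no neighbour in [L ++ I2 ++ S], a neighbour in [Z] is refuted by a theta on the hole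
   made of [Q] and [L]. Its arcs are [z1], a part of [Z], and [S'], which contains [L] and [X]. They
   would have equal size, but [size Z] is below [l/2] by about [size X], while [size L] is at least
   [l/2 - 3]. *)
have [vC|nvC] := boolP (has (edge v) (L ++ I2 ++ S)); last first.
  rewrite has_cat negb_or nvC andbT; apply/negP => vZ.
  have [z1 [J' [z2 [EZ J'0 [vh vl] nz1 nz2]]]] := hull d vZ.
  have z10 : 0 < size z1.
    case: (z1) EZ => // EZ; move: nvZ; rewrite EZ /= head_cat_nonempty // vh //.
  have := theta_hole hC I10 I20 S0 pQ _ dQ attQ.
  rewrite {1}/Q size_cat => /(_ ltac:(clia)) /hole_rev; rewrite rev_cat revK.
  rewrite /Q -!catA => /hole_catC; rewrite rev_cons rev_rcons -!catA EZ -!catA.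
  set S' := z2 ++ _ => hC1.
  have S'0 : size S' = size z2 + size L + size X + 2.
    by rewrite /S' !size_cat /= size_rcons size_rev; clia.
  have hI1C : last d I1 \in C by rewrite /C mem_cat mem_last_default.
  have hI2C : head d I2 \in C by rewrite /C !mem_cat mem_head_default ?orbT.
  have inC1 x : x \in J ++ z1 ++ J' ++ S' -> x \in Q \/ x \in C.
    rewrite /S' /Q EZ !mem_cat inE mem_rcons inE mem_rev.
    case/orP=> [h|]; first by left; rewrite h /= ?orbT.
    case/orP=> [h|]; first by left; rewrite h /= ?orbT.
    case/orP=> [h|]; first by left; rewrite h /= ?orbT.
    case/orP=> [h|]; first by left; rewrite h /= ?orbT.
    case/orP=> [/or3P[/eqP->|/eqP->|h]|->]; [right|right|right|by left].
    - by move: hI2C; rewrite /C !mem_cat.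
    - by move: hI1C; rewrite /C !mem_cat.
    - by rewrite h orbT.
  have attC1 : attached t J J' (J ++ z1 ++ J' ++ S').
    split=> // z x zt /inC1[xQ|xC] zx.
      case: (tQ _ _ zt xQ zx) => -[Ez xI]; [by left|right; split=> //].
      move: xI zx; rewrite EZ Ez !mem_cat => /or3P[/nz1/negPf->|//|/nz2/negPf->] //.
    have [Ez xT] := tC _ _ zt xC zx.
    by case/negP: nvC; apply/hasP; exists x; rewrite // /v -Ez.
  have dC1 : disj t (J ++ z1 ++ J' ++ S').
    by move=> x xt; apply/negP => /inC1[|]; apply/negP; [apply: dtQ|apply: dtC].
  have [|e5 e6 _ _ _] := theta hC1 J0 J'0 z10 _ pt t2 dC1 attC1; first by clia.
  have := congr1 size EZ; rewrite !size_cat; clia.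
have [e1 [J3 [e2 [ET J30 [vh vl] ne1 ne2]]]] := hull d vC.
have e10 : 0 < size e1.
  case: (e1) ET => // ET; move: nvL.
  by rewrite -(head_cat_nonempty d (I2 ++ S) L0) ET /= head_cat_nonempty // vh.
have e20 : 0 < size e2.
  case: (e2) ET => // ET; move: nvS.
  rewrite -(last_cat_nonempty d I2 S0) -(last_cat_nonempty d L) ?ET
    ?size_cat; last by clia.
  by rewrite cats0 last_cat_nonempty // vl.
pose R := rcons X (head d J) ++ t.
have pX : ipath (rcons X (head d J)).
  apply: (@ipath_infix _ [::] _ (J1 ++ Z)).
  by rewrite /= cat_rcons -cat_cons -EJ1.
have subXQ x : x \in rcons X (head d J) -> x \in Q.
  by rewrite /Q mem_rcons inE !mem_cat => /predU1P[->|->//]; rewrite hdJ orbT.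
have pR : ipath R.
  apply: (ipath_cat (d := d)) => //.
    by move=> x /subXQ xQ; apply/negP => /dtQ; rewrite xQ.
  move=> x z xX zt; rewrite last_rcons.
  apply/idP/andP=> [|[/eqP-> /eqP->]]; last first.
    by rewrite edge_sym.
  rewrite edge_sym => /(tQ _ _ zt (subXQ _ xX)) [] [-> xI]; rewrite ?eqxx.
    by move: xX; rewrite mem_rcons inE => /predU1P[->|/dXJ]; rewrite ?eqxx ?xI.
  move: xX xI; rewrite mem_rcons inE => /predU1P[->|/dXZ->//].
  by rewrite dJZ.
have dR : disj R (I1 ++ e1 ++ J3 ++ e2).
  rewrite -ET -/C => x; rewrite mem_cat => /orP[/subXQ/dQ//|/dtC//].
have hdR : head d R = head d Q.
  rewrite hdQ /R head_cat_nonempty ?size_rcons // -cats1 head_cat_nonempty //.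
  by clia.
have lsR : last d R = v by rewrite /R last_cat_nonempty.
have R2 : 2 <= size R by rewrite size_cat size_rcons; clia.
have hC3 : hole (I1 ++ e1 ++ J3 ++ e2) by rewrite -ET.
have attR : attached R I1 J3 (I1 ++ e1 ++ J3 ++ e2).
  rewrite -ET -/C /attached hdR lsR; split=> // z x zR xC zx.
  move: zR; rewrite mem_cat => /orP[zX|zt]; [left|right].
    case: (crQ _ _ (subXQ _ zX) xC zx) => // -[Ez _].
    move: zX; rewrite mem_rcons inE {}Ez lsQ => /predU1P[E|/dXZ].
      by have := dJZ _ hdJ; rewrite -E lsZ.
    by rewrite lsZ.
  have [-> xT] := tC _ _ zt xC zx; split=> //.
  have [Ez _] := tC _ _ zt xC zx; move: zx xT; rewrite ET Ez -/v !mem_cat.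
  by move=> vx /or3P[/ne1|//|/ne2]; rewrite vx.
have [lenE1 lenE2 _ _ [J33 J3all]] := theta hC3 I10 J30 e10 e20 pR R2 dR attR.
rewrite /R size_cat size_rcons in lenE1 lenE2.
have lenT := congr1 size ET; rewrite !size_cat in lenT.
(* Both [I2] and [J3] are centred in the same list, since the arcs on either side of each have equal
   size; so they share a vertex. *)
have [b [bI2 bJ3]] : exists b, b \in I2 /\ b \in J3.
  have [i [Li ei iI2 iJ3]] : exists i,
      [/\ size L <= i, size e1 <= i, i < size L + size I2 & i < size e1 + size J3].
    by exists (maxn (size L) (size e1)); split; clia.
  exists (nth d (L ++ I2 ++ S) i); split.
    rewrite !nth_cat; have -> : i < size L = false by clia.
    have -> : i - size L < size I2 by clia.
    by apply: mem_nth; clia.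
  rewrite ET !nth_cat; have -> : i < size e1 = false by clia.
  have -> : i - size e1 < size J3 by clia.
  by apply: mem_nth; clia.
have ub : edge (last d Q) b by apply: I2all.
have vb : edge v b by rewrite -lsR; apply: J3all.
have bC : b \in C by rewrite /C !mem_cat bI2 !orbT.
(* Closing up [t] through a part [z] of [Z] forces [size z + 2 + size t = l]. The two thetas bound
   [size X + size Z] and [size X + size t] by about [l/2], so with 20 vertices in [X] the sum is too
   small. *)
have arc (z : seq G) y : ipath (last d J :: rcons z y) -> {subset z <= Z} ->
    {in z, forall x, ~~ edge v x} -> y \notin t -> edge v y ->
    {in t, forall x, edge x y -> x = v} -> size z + 2 + size t = l.
  move=> pA zZ nz yNt vy ty.
  suff: size (last d J :: rcons z y) + size t = l by rewrite /= size_rcons; clia.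
  have ZQ x : x \in Z -> x \in Q by rewrite /Q !mem_cat => ->; rewrite !orbT.
  have lJQ : last d J \in Q by rewrite /Q !mem_cat lsJ orbT.
  apply/size_cat_rev_hole/ends_hole => //=; rewrite ?size_rcons ?last_rcons //.
  - move=> x; rewrite inE mem_rcons inE => /or3P[/eqP->|/eqP->//|xz].
      by apply/negP => /dtQ; rewrite lJQ.
    by apply/negP => /dtQ; rewrite ZQ ?zZ.
  - by clia.
  - by rewrite edge_sym.
  - by rewrite edge_sym.
  - move=> x w; rewrite inE mem_rcons inE => xA wt; rewrite edge_sym => wx.
    case/or3P: xA wx => [/eqP->|/eqP->|xz] wx.
    + by case: (tQ _ _ wt lJQ wx) => -[-> xI]; [left|rewrite dJZ in xI].
    + by right; split=> //; apply: ty.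
    + case: (tQ _ _ wt (ZQ _ (zZ _ xz)) wx) => -[Ew xI].
        by have := dJZ _ xI; rewrite zZ.
      by have := nz _ xz; rewrite /v -Ew wx.
(* The arc ends at the first neighbour of [v] in [Z] if there is one, and otherwise at [b], the
   common neighbour of [v] and [last d Q]. *)
have [vZ|nvZall] := boolP (has (edge v) Z).
  have [z1 [J' [z2 [EZ J'0 [vh' vl'] nz1 nz2]]]] := hull d vZ.
  have hdJ'Z : head d J' \in Z.
    by rewrite EZ !mem_cat mem_head_default // orbT.
  have [J'1 EJ'1] : exists s, J' = head d J' :: s.
    by case: (J') J'0 => // a s _; exists s.
  suff: size z1 + 2 + size t = l.
    by have := congr1 size EZ; rewrite !size_cat; clia.
  apply: (arc z1 (head d J')) => //.
  - apply: (@ipath_infix _ (X ++ J2) _ (J'1 ++ z2)).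
    rewrite -catA cat_cons -cat_rcons -EJ2 cat_rcons -cat_cons -EJ'1 -EZ.
    exact: pQ.
  - by move=> x xz; rewrite EZ mem_cat xz.
  - by apply/negP => /dtQ; rewrite /Q !mem_cat hdJ'Z !orbT.
  - move=> z zt zx; have xQ : head d J' \in Q by rewrite /Q !mem_cat hdJ'Z !orbT.
    by case: (tQ _ _ zt xQ zx) => -[// _ /dJZ]; rewrite hdJ'Z.
suff: size Z + 2 + size t = l by clia.
apply: (arc Z b) => //.
- rewrite -rcons_cons -cats1; apply: (ipath_cat (d := d)).
  + apply: (@ipath_infix _ (X ++ J2) _ [::]).
    by rewrite cats0 -catA -cat_rcons -EJ2; apply: pQ.
  + by split=> // x y; rewrite !inE => /eqP-> /eqP->; rewrite edge_irr /= eqxx.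
  + move=> x xA; rewrite inE; apply: contraTneq bC => <-; apply: dQ.
    move: xA; rewrite inE /Q !mem_cat => /predU1P[->|->]; rewrite ?orbT //.
    by rewrite lsJ orbT.
  + move=> x y xA; rewrite inE => /eqP->; rewrite eqxx andbT.
    have -> : last d (last d J :: Z) = last d Q.
      by rewrite lsQ; case: (Z) Z20.
    apply/idP/eqP=> [xb|->//]; have xQ : x \in Q.
      move: xA; rewrite inE /Q !mem_cat => /predU1P[->|->]; rewrite ?orbT //.
      by rewrite lsJ orbT.
    case: (crQ _ _ xQ bC xb) => -[// Ex _]; move: xA; rewrite Ex hdQ inE.
    by case/predU1P => [E|]; [have := dXJ _ hdX; rewrite E lsJ|rewrite dXZ].
- by move=> x xZ; apply: contra nvZall => vx; apply/hasP; exists x.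
- by apply/negP => /dtC; rewrite bC.
- by move=> z zt zb; case: (tC _ _ zt bC zb).
Qed.

End Monoholed.

(** * Neighbourhoods, distances between sets and shortest links *)

Section Neighbourhoods.
Variables (G : sgraph) (d : G).
Implicit Types (X Y W U V : {set G}) (s t : seq G) (x y z : G).

Definition nbhd X : {set G} :=
  [set y | (y \in X) || [exists x in X, edge x y]].

(* Locked because [inE] would unfold it. *)
Definition near := locked (fun n X => iter n nbhd X).

Lemma nearE n X : near n X = iter n nbhd X.
Proof. by rewrite /near -lock. Qed.

Lemma near0 X x : x \in X -> x \in near 0 X. Proof. by rewrite nearE. Qed.

Lemma near_edge n X x y : x \in near n X -> edge x y -> y \in near n.+1 X.
Proof.
rewrite !nearE => xX xy; rewrite /= inE; apply/orP; right; apply/existsP; exists x.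
by rewrite xX.
Qed.

Lemma nearW n m X x : n <= m -> x \in near n X -> x \in near m X.
Proof.
move=> /subnKC <-; rewrite !nearE addnC iterD; move: (m - n) => k xX.
by elim: k => //= k IH; rewrite inE IH.
Qed.

Lemma sub_near n X x : x \in X -> x \in near n X.
Proof. by move/near0/nearW; apply. Qed.

Lemma near1_edge X x y : x \in X -> edge y x -> y \in near 1 X.
Proof. by rewrite edge_sym => /near0/near_edge; apply. Qed.

Lemma near1P X y : y \in near 1 X -> y \notin X -> exists2 x, x \in X & edge x y.
Proof.
by rewrite nearE inE => /orP[->//|/existsP[x /andP[xX xy]] _]; exists x.
Qed.

Lemma near_subset a b X Y x : {subset X <= near b Y} ->
  x \in near a X -> x \in near (a + b) Y.
Proof.
rewrite !nearE iterD -nearE => XY.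
elim: a x => [|a IH] x /=; first exact: XY.
rewrite !inE => /orP[/IH->//|/existsP[z /andP[/IH zX zx]]].
by apply/orP; right; apply/existsP; exists z; rewrite zX.
Qed.

Lemma near_walk n X y : y \in near n X -> exists x p,
  [/\ x \in X, path (@edge G) x p, last x p = y & size p <= n].
Proof.
rewrite nearE; elim: n y => [|n IH] y; first by move=> yX; exists y, [::].
rewrite /= inE => /orP[/IH[x [p [xX pp lp sp]]]|].
  by exists x, p; split=> //; apply: leqW.
case/existsP=> z /andP[/IH[x [p [xX pp lp sp]]] zy].
exists x, (rcons p y); split=> //; last by rewrite size_rcons.
- by rewrite rcons_path pp lp.
- by rewrite last_rcons.
Qed.

(** Arbitrary walks are used instead of simple paths, so that they can be concatenated freely. *)
Definition far K X Y := forall x y p, x \in X -> y \in Y ->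
  path (@edge G) x p -> last x p = y -> K <= size p.

Lemma rev_walk x p y : path (@edge G) x p -> last x p = y ->
  exists q, [/\ path (@edge G) y q, last y q = x, size q = size p &
    y :: q =i x :: p].
Proof.
move=> pp lp; exists (rev (belast x p)); split.
- rewrite -{1}lp rev_path; apply: sub_path pp => a b.
  by rewrite edge_sym.
- by rewrite -lp; case: (p) => //= a s; rewrite rev_cons last_rcons.
- by rewrite size_rev size_belast.
- by move=> z; rewrite [in RHS]lastI -lp -rev_rcons mem_rev.
Qed.

Lemma far_near K X Y z a b : far K X Y -> z \in near a X -> z \in near b Y ->
  a + b < K -> False.
Proof.
move=> F /near_walk[x [p [xX pp lp sp]]] /near_walk[y [q [yY pq lq sq]]].
have [r [pr lr sr _]] := rev_walk pq lq.
have := F x y (p ++ r) xX yY; rewrite cat_path pp lp pr last_cat lp lr size_cat.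
by move=> /(_ isT erefl); lia.
Qed.

Lemma far_sym K X Y : far K X Y -> far K Y X.
Proof.
move=> F x y p xX yY pp lp; have [q [pq lq <- _]] := rev_walk pp lp.
exact: F pq lq.
Qed.

Lemma ipath_edge s i : ipath s -> i.+1 < size s ->
  edge (nth d s i) (nth d s i.+1).
Proof.
move=> [U h] i1; have i0 : i < size s by clia.
by rewrite h ?mem_nth // !index_uniq // eqxx.
Qed.

Lemma ipath_near s a X : ipath s -> 0 < size s -> head d s \in near a X ->
  last d s \in near (a + (size s).-1) X.
Proof.
move=> ps s0 hs; rewrite -nth_last; have : (size s).-1 < size s by clia.
elim: (size s).-1 => [|i IH] lti; first by rewrite nth0 addn0.
rewrite addnS; apply: (near_edge (IH _)); first exact: ltnW.
exact: ipath_edge.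
Qed.

Lemma far_ipath K X Y s a b : far K X Y -> ipath s -> 0 < size s ->
  head d s \in near a X -> last d s \in near b Y -> K < a + b + size s.
Proof.
move=> F ps s0 hs ls; rewrite ltnNge; apply/negP => le.
by apply: (far_near F (ipath_near ps s0 hs) ls); clia.
Qed.

Definition within W := [rel a b | [&& a \in W, b \in W & @edge G a b]].

(** This is connectivity of the subgraph induced by [W]; the empty set counts as connected. *)
Definition conn W := {in W &, forall x y, connect (within W) x y}.

Lemma within_sym W : symmetric (within W).
Proof. by move=> a b /=; rewrite edge_sym andbCA. Qed.

Lemma connU W V x : conn W -> conn V -> x \in W -> x \in V -> conn (W :|: V).
Proof.
move=> cW cV xW xV.
have to y : y \in W :|: V -> connect (within (W :|: V)) x y.
  rewrite inE => /orP[yW|yV].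
    apply: connect_sub (cW _ _ xW yW) => a b /= /and3P[aW bW ab].
    by rewrite connect1 //= !inE aW bW ab.
  apply: connect_sub (cV _ _ xV yV) => a b /= /and3P[aW bW ab].
  by rewrite connect1 //= !inE aW bW ab !orbT.
move=> y z /to xy /to xz; apply: connect_trans xz.
by rewrite (sym_connect_sym (@within_sym _)).
Qed.

Lemma conn_walk x p : path (@edge G) x p -> conn [set z in x :: p].
Proof.
elim: p x => [|y p IH] x /=.
  by move=> _ a b; rewrite !inE => /eqP-> /eqP->; apply: connect0.
case/andP=> xy pp.
have c2 : conn [set x; y].
  move=> a b /set2P[]-> /set2P[]->; rewrite ?connect0 //; apply: connect1.
    by rewrite /= !inE !eqxx orbT.
  by rewrite /= !inE !eqxx orbT edge_sym.
have -> : [set z in [:: x, y & p]] = [set x; y] :|: [set z in y :: p].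
  by apply/setP=> z; rewrite !inE orbA -!orbA; do !case: (_ == _).
by apply: (connU (x := y)) (IH _ pp) _ _ => //; rewrite !inE eqxx ?orbT.
Qed.

Lemma ex_min_size (P : seq G -> Prop) : (exists s, P s) ->
  exists2 s, P s & forall t, P t -> size s <= size t.
Proof.
move=> [s0 Ps0].
have exn : exists n, `[< exists2 s, P s & size s = n >].
  by exists (size s0); apply/asboolP; exists s0.
case: (ex_minnP exn) => n /asboolP[s Ps <-] min_n.
by exists s => // t Pt; apply: min_n; apply/asboolP; exists t.
Qed.

(** Take a walk inside [W] from [U] to [V] with fewest vertices. A repetition or a chord would allow
    a shortcut, and an inner visit to [U] or [V] would allow a truncation. *)
Lemma shortest_link W U V x y : conn W -> x \in W -> x \in U ->
    y \in W -> y \in V ->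
  exists s, [/\ 0 < size s, {subset s <= W}, ipath s,
    head d s \in U /\ last d s \in V &
    {in s, forall z, z \in U -> z = head d s} /\
    {in s, forall z, z \in V -> z = last d s}].
Proof.
move=> cW xW xU yW yV.
pose P s := [/\ 0 < size s, {subset s <= W}, sorted (@edge G) s,
  head d s \in U & last d s \in V].
have [|s Ps min_s] := @ex_min_size P.
  have /connectP[p pp lp] := cW _ _ xW yW; exists (x :: p); split=> //=.
  - move=> z; elim: p x xW pp {lp xU} => [|a p IH] b bW /=.
      by rewrite inE => _ /eqP->.
    case/andP=> /and3P[_ aW _] /(IH a aW) h; rewrite inE => /predU1P[->//|].
    exact: h.
  - by apply: sub_path pp => a b /and3P[].
  - by rewrite -lp.
have Us : uniq s.
  case: s Ps min_s => // a p [_ sW sE sU sV] min_s; move: sE sV => /=.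
  case/shortenP=> q pq Uq qp lq.
  have Pq : P (a :: q).
    split=> // z; rewrite inE => /predU1P[->|/qp zp]; apply: sW.
      exact: mem_head.
    by rewrite inE zp orbT.
  have := min_s _ Pq; rewrite /= ltnS => sp.
  rewrite -[_ && _]/(uniq (a :: p)); apply: (leq_size_uniq Uq) => // z.
  rewrite !inE => /predU1P[->|/qp->].
    by rewrite eqxx.
  by rewrite orbT.
have [s0 sW sE sU sV] := Ps.
have split1 z : z \in s -> exists a b, s = a ++ z :: b.
  by case/splitPr=> a b; exists a, b.
have U_head z : z \in s -> z \in U -> z = head d s.
  case/split1=> a [b Es] zU; have : P (z :: b).
    move: Ps; rewrite Es => -[_ bW]; rewrite sorted_cat_cons => /andP[_ pb] _.
    rewrite last_cat_nonempty // => lV; split=> // w wb; apply: bW.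
    by rewrite mem_cat wb orbT.
  by move/min_s; rewrite Es size_cat; case: (a) => //= ? ?; clia.
have V_last z : z \in s -> z \in V -> z = last d s.
  case/split1=> a [b Es] zV; have : P (rcons a z).
    move: Ps; rewrite Es => -[_ bW]; rewrite sorted_cat_cons => /andP[pa _].
    move=> hU _; split=> //; rewrite ?size_rcons ?last_rcons //.
      move=> w; rewrite -cats1 mem_cat inE => wb; apply: bW.
      by rewrite mem_cat inE; case/orP: wb => ->; rewrite ?orbT.
    by move: hU; rewrite -cats1; case: (a).
  move/min_s; rewrite Es size_cat size_rcons.
  by case: b Es => [|? ?] Es /=; [rewrite last_cat|clia].
exists s; split=> //; split=> // x1 y1 xs ys.
wlog: x1 y1 xs ys / index x1 s < index y1 s.
  move=> Hw; have [E|] := eqVneq (index x1 s) (index y1 s).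
    have -> : x1 = y1 by apply: (index_inj _ xs ys E).
    by rewrite edge_irr; lia.
  by rewrite neq_ltn => /orP[/Hw->//|/Hw H]; rewrite edge_sym H // orbC.
move=> ltxy; have [a [b [c [Es ix iy]]]] := split_index2 xs ys ltxy.
case: b Es iy => [|z b] Es iy.
  have -> : edge x1 y1.
    by move: sE; rewrite Es sorted_cat_cons /= => /andP[_ /andP[]].
  by rewrite ix iy addn1 eqxx.
have -> : edge x1 y1 = false.
  apply/negP => xy; have : P (a ++ x1 :: y1 :: c).
    move: Ps; rewrite Es => -[_ bW]; rewrite !sorted_cat_cons cat_path /=.
    move=> /and3P[pa _ /andP[_ pc]] hU lV.
    split; rewrite ?size_cat ?addnS //.
    - move=> w; rewrite mem_cat !inE => wb; apply: bW.
      by rewrite mem_cat !inE mem_cat !inE; case/or4P: wb => ->; rewrite ?orbT.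
    - by rewrite sorted_cat_cons pa /= xy.
    - by move: hU; case: (a).
    - by move: lV; rewrite !last_cat /= last_cat.
  by move/min_s; rewrite Es !size_cat /= !size_cat /=; clia.
by rewrite ix iy /=; lia.
Qed.

(** Linking the closed neighbourhoods keeps the path off [U] and [V] themselves: a vertex of the
    path in [U] would put both itself and a neighbour on the path into [near 1 U], where only the
    head lies. The neighbour exists because disjoint neighbourhoods force two vertices. *)
Lemma link W U V x y : conn W -> x \in W -> x \in near 1 U ->
    y \in W -> y \in near 1 V ->
    (forall z, z \in near 1 U -> z \in near 1 V -> False) ->
  exists s, [/\ 2 <= size s, {subset s <= W}, ipath s,
    {in s, forall z, z \notin U /\ z \notin V} &
    [/\ head d s \in near 1 U, last d s \in near 1 V,
    {in s, forall z, z \in near 1 U -> z = head d s} &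
    {in s, forall z, z \in near 1 V -> z = last d s}]].
Proof.
move=> cW xW xU yW yV dUV.
have [s [s0 sW ps [hU lV] [U_head V_last]]] := shortest_link cW xW xU yW yV.
have s2 : 2 <= size s.
  by case: (s) s0 hU lV => [|a [|b t]] //= _ /dUV.
exists s; split=> // z zs; have [w ws zw] := ipath_nbr d ps s2 zs.
split; apply/negP => zX.
- have := U_head z zs (nearW (ltnW (ltnSn 0)) (near0 zX)).
  have := U_head w ws (near_edge (near0 zX) zw) => <- Ez.
  by rewrite Ez edge_irr in zw.
- have := V_last z zs (nearW (ltnW (ltnSn 0)) (near0 zX)).
  have := V_last w ws (near_edge (near0 zX) zw) => <- Ez.
  by rewrite Ez edge_irr in zw.
Qed.

End Neighbourhoods.

(** * Fat fans *)

(* A fat minor model of [U4] with the two vertices of degree 2 suppressed: the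
   hubs are [A] (the apex), [B] and [D]; [P1] and [P2] link [A] to [B], [Q1] and
   [Q2] link [A] to [D], and [M] links [B] to [D]. *)
Record fan (G : sgraph) K (A B D P1 P2 M Q1 Q2 : {set G}) : Prop := Fan {
  fan_conn : [/\ conn A, conn B & conn D] /\
    [/\ conn P1, conn P2, conn M, conn Q1 & conn Q2];
  fan_AB_meet : [/\ A :&: P1 != set0, A :&: P2 != set0,
    B :&: P1 != set0 & B :&: P2 != set0];
  fan_AD_meet : [/\ A :&: Q1 != set0, A :&: Q2 != set0,
    D :&: Q1 != set0 & D :&: Q2 != set0];
  fan_BD_meet : B :&: M != set0 /\ D :&: M != set0;
  fan_hubs : [/\ far K A B, far K A D & far K B D];
  fan_hub_link : [/\ far K A M, far K B Q1, far K B Q2, far K D P1 & far K D P2];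
  fan_links1 : [/\ far K P1 P2, far K P1 M, far K P1 Q1 & far K P1 Q2];
  fan_links2 : [/\ far K P2 M, far K P2 Q1 & far K P2 Q2];
  fan_links3 : [/\ far K M Q1, far K M Q2 & far K Q1 Q2]
}.

(** Finds a vertex close to two sets that are far apart. The inequality [a + b < K] is closed by
    computation, with the numeral 30 for [K]. *)
Ltac far_absurd := exfalso; match goal with
  | F : far _ ?X ?Y |- _ =>
    first
    [ match goal with
      | h1 : is_true (@in_mem _ ?z (@mem _ _ (@pred_of_set _ (@near _ ?a X)))),
        h2 : is_true (@in_mem _ ?z (@mem _ _ (@pred_of_set _ (@near _ ?b Y))))
        |- _ => exact: (far_near F h1 h2 isT)
      end
    | match goal with
      | h1 : is_true (@in_mem _ ?z (@mem _ _ (@pred_of_set _ (@near _ ?a X)))),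
        h2 : is_true (@in_mem _ ?z (@mem _ _ (@pred_of_set _ Y)))
        |- _ => exact: (far_near F h1 (near0 h2) isT)
      end
    | match goal with
      | h1 : is_true (@in_mem _ ?z (@mem _ _ (@pred_of_set _ X))),
        h2 : is_true (@in_mem _ ?z (@mem _ _ (@pred_of_set _ (@near _ ?b Y))))
        |- _ => exact: (far_near F (near0 h1) h2 isT)
      end
    | match goal with
      | h1 : is_true (@in_mem _ ?z (@mem _ _ (@pred_of_set _ X))),
        h2 : is_true (@in_mem _ ?z (@mem _ _ (@pred_of_set _ Y)))
        |- _ => exact: (far_near F (near0 h1) (near0 h2) isT)
      end ]
  end.

(** * Absence of 30-fat fans in monoholed graphs *)

Section Fan.
Variables (G : sgraph) (d : G) (l : nat).
Hypothesis holes_l : forall c : seq G, hole c -> size c = l.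
Implicit Types (A B D P M Q : {set G}) (s t c : seq G) (x y z : G).

(** Shortest links inside [P1] and [P2] are joined by shortest links inside the hubs. A hub link
    connects the neighbours of one end to the neighbours of another and meets these neighbourhoods
    only at its own ends, so no chord arises. *)
Lemma ring_hole A B P1 P2 : conn A -> conn B -> conn P1 -> conn P2 ->
    A :&: P1 != set0 -> A :&: P2 != set0 -> B :&: P1 != set0 ->
    B :&: P2 != set0 -> far 30 A B -> far 30 P1 P2 ->
  exists b p a q,
    [/\ hole (b ++ q ++ a ++ p), [/\ 0 < size q & 0 < size p],
      {subset b <= near 1 B} /\ {subset a <= near 1 A},
      {in p, forall x, [/\ x \in P1, x \notin near 1 A & x \notin near 1 B]} /\
      {in q, forall x, [/\ x \in P2, x \notin near 1 A & x \notin near 1 B]} &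
      (exists2 x, x \in a & x \in A) /\ (exists2 x, x \in b & x \in B)].
Proof.
move=> cA cB cP1 cP2 /set0Pn[a1 /setIP[a1A a1P]] /set0Pn[a2 /setIP[a2A a2P]]
  /set0Pn[b1 /setIP[b1B b1P]] /set0Pn[b2 /setIP[b2B b2P]] FAB FP.
have dAB z : z \in near 1 A -> z \in near 1 B -> False.
  by move=> h1 h2; far_absurd.
have [p [p2 pP pp pAB [hp lp p_head p_last]]] :=
  link d cP1 a1P (sub_near 1 a1A) b1P (sub_near 1 b1B) dAB.
have [q [q2 qP pq qAB [hq lq q_head q_last]]] :=
  link d cP2 a2P (sub_near 1 a2A) b2P (sub_near 1 b2B) dAB.
have p0 : 0 < size p by clia.
have q0 : 0 < size q by clia.
have szp := far_ipath FAB pp p0 hp lp.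
have szq := far_ipath FAB pq q0 hq lq.
have hpp : head d p \in p by rewrite mem_head_default.
have lpp : last d p \in p by rewrite mem_last_default.
have hqq : head d q \in q by rewrite mem_head_default.
have lqq : last d q \in q by rewrite mem_last_default.
have hub (X : {set G}) x y : conn X -> x \in near 1 X -> x \notin X ->
    y \in near 1 X -> y \notin X ->
    exists s, [/\ 0 < size s, {subset s <= X}, ipath s,
      edge x (head d s) /\ edge y (last d s) &
      {in s, forall z, edge x z -> z = head d s} /\
      {in s, forall z, edge y z -> z = last d s}].
  move=> cX xX xNX yX yNX; have [x' x'X ex] := near1P xX xNX.
  have [y' y'X ey] := near1P yX yNX.
  have := @shortest_link _ d X [set z | edge x z] [set z | edge y z] x' y' cX x'X.
  rewrite !inE !(edge_sym _ x') !(edge_sym _ y') => /(_ ex y'X ey).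
  move=> [s [s0 sX ps [hs ls] [h1 h2]]]; exists s; rewrite !inE in hs ls.
  by split=> //; split=> z zs e; [apply: h1|apply: h2]; rewrite ?inE.
have [r [r0 rA pr [er1 er2] [r_head r_last]]] :=
  hub A _ _ cA hp (proj1 (pAB _ hpp)) hq (proj1 (qAB _ hqq)).
have [s [s0 sB ps [es1 es2] [s_head s_last]]] :=
  hub B _ _ cB lp (proj2 (pAB _ lpp)) lq (proj2 (qAB _ lqq)).
have pN x : x \in p -> x \notin r /\ x \notin s.
  by move=> /pAB[xA xB]; split; [apply: contra xA => /rA|apply: contra xB => /sB].
have qN x : x \in q -> x \notin r /\ x \notin s.
  by move=> /qAB[xA xB]; split; [apply: contra xA => /rA|apply: contra xB => /sB].
have rp_edge (t : seq G) x y : {in t, forall z, z \in near 1 A -> z = head d t} ->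
    x \in r -> y \in t -> edge x y -> y = head d t.
  by move=> t_head xr yt xy; apply: t_head (near_edge (near0 (rA _ xr)) xy).
have sp_edge (t : seq G) x y : {in t, forall z, z \in near 1 B -> z = last d t} ->
    x \in s -> y \in t -> edge x y -> y = last d t.
  by move=> t_last xs yt xy; apply: t_last (near_edge (near0 (sB _ xs)) xy).
have rs_edge x y : x \in r -> y \in s -> edge x y = false.
  move=> /rA xA /sB yB; apply/negP => xy.
  by have := near_edge (near0 xA) xy => y1; far_absurd.
have rs x : x \in r -> x \notin s.
  by move=> /rA xA; apply/negP => /sB xB; far_absurd.
have Erp : ipath (rev r ++ p).
  apply: (ipath_cat (d := d)) => //; first exact: ipath_rev.
    by move=> x; rewrite mem_rev; apply: contraL => /pN[].
  move=> x y; rewrite mem_rev last_rev => xr yp; apply/idP/andP=> [xy|[/eqP-> /eqP->]].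
    have Ey := rp_edge _ _ _ p_head xr yp xy; split; apply/eqP => //.
    by apply: r_head => //; rewrite -Ey edge_sym.
  by rewrite edge_sym.
have hole1 : hole ((rev r ++ p ++ s) ++ rev q).
  have hd1 : head d (rev r ++ p ++ s) = last d r.
    by rewrite head_cat_nonempty ?size_rev // head_rev.
  have ls1 : last d (rev r ++ p ++ s) = last d s.
    by rewrite catA last_cat_nonempty.
  apply: (ends_hole (d := d)) => //; rewrite ?hd1 ?ls1 ?size_cat //; try clia.
  - rewrite catA; apply: (ipath_cat (d := d)) => //.
      move=> x; rewrite mem_cat mem_rev => /orP[/rs//|/pN[]//].
    move=> x y; rewrite mem_cat mem_rev last_cat_nonempty // => xrp ys.
    apply/idP/andP=> [xy|[/eqP-> /eqP->]//].
    case/orP: xrp => [xr|xp]; first by rewrite rs_edge in xy.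
    rewrite edge_sym in xy; have Ex := sp_edge _ _ _ p_last ys xp xy.
    by split; apply/eqP => //; apply: s_head => //; rewrite -Ex edge_sym.
  - move=> x; rewrite !mem_cat mem_rev => /or3P[|xp|]; try by apply: contraL => /qN[].
    by apply/negP => /qP xP2; have := pP _ xp => xP1; far_absurd.
  - by rewrite edge_sym.
  - by rewrite edge_sym.
  - move=> x y; rewrite !mem_cat mem_rev => xrps yq xy.
    case/or3P: xrps => [xr|xp|xs].
    + have Ey := rp_edge _ _ _ q_head xr yq xy; left; split=> //.
      by apply: r_last => //; rewrite -Ey edge_sym.
    + have := near_edge (near0 (pP _ xp)) xy => y1; have := qP _ yq => y2.
      by far_absurd.
    + have Ey := sp_edge _ _ _ q_last xs yq xy; right; split=> //.
      by apply: s_last => //; rewrite -Ey edge_sym.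
(* The end vertices of [p] and [q] are within distance 1 of the hubs, so they are moved into the hub
   parts of the hole; the interiors avoid both neighbourhoods. *)
have [p' Ep] : exists p', p = head d p :: rcons p' (last d p).
  case: (p) p2 => // a [|b p''] //= _.
  case/lastP: p'' => [|t c]; first by exists [::].
  by exists (b :: t); rewrite /= last_rcons.
have [q' Eq] : exists q', q = head d q :: rcons q' (last d q).
  case: (q) q2 => // a [|b p''] //= _.
  case/lastP: p'' => [|t c]; first by exists [::].
  by exists (b :: t); rewrite /= last_rcons.
have inner t t' : uniq t -> t = head d t :: rcons t' (last d t) ->
    {in t, forall z, z \in near 1 A -> z = head d t} ->
    {in t, forall z, z \in near 1 B -> z = last d t} ->
    {in t', forall x, [/\ x \in t, x \notin near 1 A & x \notin near 1 B]}.
  move=> + Et t_head t_last x xt'; rewrite {1}Et /= mem_rcons inE rcons_uniq negb_or.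
  case/andP=> /andP[_ hN] /andP[lN _].
  have xt : x \in t by rewrite Et inE mem_rcons inE xt' !orbT.
  split=> //; apply/negP.
    by move/(t_head x xt) => E; rewrite -E xt' in hN.
  by move/(t_last x xt) => E; rewrite -E xt' in lN.
exists (last d p :: rcons s (last d q)), p', (head d q :: rcons (rev r) (head d p)).
exists (rev q'); split.
- have E : (rev r ++ p ++ s) ++ rev q = (rev r ++ head d p :: p') ++
      (last d p :: rcons s (last d q)) ++ rev q' ++ [:: head d q].
    by rewrite {1}Ep {1}Eq rev_cons rev_rcons -!cats1 /= -!catA /= -!catA.
  move: hole1; rewrite E => /hole_catC.
  by rewrite -!cats1 /= -!catA /=.
- by rewrite size_rev; split; have := congr1 size Ep; have := congr1 size Eq;
    rewrite /= !size_rcons; clia.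
- split=> x; rewrite inE mem_rcons inE ?mem_rev.
    case/or3P=> [/eqP->//|/eqP->//|/sB xB]; exact: (sub_near 1 xB).
  case/or3P=> [/eqP->//|/eqP->//|/rA xA]; exact: (sub_near 1 xA).
- have Hp := inner p p' (proj1 pp) Ep p_head p_last.
  have Hq := inner q q' (proj1 pq) Eq q_head q_last.
  split=> x; rewrite ?mem_rev; first by case/Hp => /pP.
  by case/Hq => /qP.
- split; [exists (head d r)|exists (head d s)].
  + by rewrite inE mem_rcons inE mem_rev mem_head_default ?orbT.
  + by apply/rA/mem_head_default.
  + by rewrite inE mem_rcons inE mem_head_default ?orbT.
  + by apply/sB/mem_head_default.
Qed.

(** The hole runs around [A], [P1], [B] and [P2]. The path [Q] leaves it at [B], passes along [M] to
    [D] and returns along [Q1] to [A]; the ear [t] starts near [D] and runs along [Q2] towards [A].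
    This configuration is excluded by [ear_near_end]. *)
Lemma no_fan A B D P1 P2 M Q1 Q2 : ~ fan 30 A B D P1 P2 M Q1 Q2.
Proof.
case=> [[[cA cB cD] [cP1 cP2 cM cQ1 cQ2]] [AP1 AP2 BP1 BP2] [AQ1 AQ2 DQ1 DQ2]
  [BM DM] [FAB FAD FBD] [FAM FBQ1 FBQ2 FDP1 FDP2] [FP1P2 FP1M FP1Q1 FP1Q2]
  [FP2M FP2Q1 FP2Q2] [FMQ1 FMQ2 FQ1Q2]].
have [b [p [a [q [hC [q0 p0] [bB aA] [pP qP] [[xa xaa xaA] [xb xbb xbB]]]]]]] :=
  ring_hole cA cB cP1 cP2 AP1 AP2 BP1 BP2 FAB FP1P2.
have n1 (X : {set G}) x : x \in X -> x \in near 1 X by apply: sub_near.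
have nb2 x : x \in near 1 [set z in b] -> x \in near 2 B.
  by apply: (@near_subset _ 1 1) => z; rewrite inE => /bB.
have na2 x : x \in near 1 [set z in a] -> x \in near 2 A.
  by apply: (@near_subset _ 1 1) => z; rewrite inE => /aA.
(* All members of the fan other than [P1] and [P2] can touch the hole only in its hub parts [a] and
   [b], since [p] and [q] avoid the neighbourhoods of the hubs. *)
have seen x y : x \in A :|: B :|: D :|: M :|: Q1 :|: Q2 -> y \in b ++ q ++ a ++ p ->
    (x == y) || edge x y -> y \in a \/ y \in b.
  move=> xZ yC xy.
  have yn (X : {set G}) : x \in X -> y \in near 1 X.
    by move=> xX; case/orP: xy => [/eqP<-|/(near_edge (near0 xX))//]; apply: n1.
  move: yC; rewrite !mem_cat => /or4P[|/qP[yP yA yB]||/pP[yP yA yB]]; auto;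
    move: xZ; rewrite !inE -!orbA => /or4P[||| /or3P[]] /yn y1;
    by [rewrite y1 in yA|rewrite y1 in yB|far_absurd].
have [z1 /setIP[z1D z1Q]] := set0Pn _ DQ1.
have [z2 /setIP[z2A z2Q]] := set0Pn _ AQ1.
have [Qa [Qa2 QaW pQa QaN [hQa lQa Qa_head Qa_last]]] :
    exists s, [/\ 2 <= size s, {subset s <= A :|: Q1}, ipath s,
    {in s, forall z, z \notin D /\ z \notin [set x in a]} &
    [/\ head d s \in near 1 D, last d s \in near 1 [set x in a],
    {in s, forall z, z \in near 1 D -> z = head d s} &
    {in s, forall z, z \in near 1 [set x in a] -> z = last d s}]].
  apply: (@link _ d _ _ _ z1 xa (connU cA cQ1 z2A z2Q)).
  - by rewrite inE z1Q orbT.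
  - exact: n1.
  - by rewrite inE xaA.
  - by apply: (n1); rewrite inE.
  - by move=> z zD /na2 zA; far_absurd.
have [a0 [Qa' EQa]] : exists a0 Qa', Qa = a0 :: Qa'.
  by case: (Qa) Qa2 => // x s _; exists x, s.
have a0Qa : a0 \in Qa by rewrite EQa mem_head.
have a0D : a0 \in near 1 D by move: hQa; rewrite EQa.
have [a0ND _] := QaN _ a0Qa.
have [y0 y0D ya0] := near1P a0D a0ND.
have na02 x : x \in near 1 [set a0] -> x \in near 2 D.
  by apply: (@near_subset _ 1 1) => z; rewrite inE => /eqP->.
have [z3 /setIP[z3B z3M]] := set0Pn _ BM.
have [z4 /setIP[z4D z4M]] := set0Pn _ DM.
have cBMD : conn (B :|: M :|: D).
  by apply: (connU (x := z4)) => //; [apply: (connU (x := z3))|rewrite inE z4M orbT].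
have y0a0 : y0 \in near 1 [set a0].
  by apply: near1_edge (set11 a0) ya0.
(* The target is the single vertex [a0], the head of [Qa], so that [Qb] and [Qa] are joined by
   exactly one edge. *)
have [Qb [Qb2 QbW pQb QbN [hQb lQb Qb_head Qb_last]]] :
    exists s, [/\ 2 <= size s, {subset s <= B :|: M :|: D}, ipath s,
    {in s, forall z, z \notin [set x in b] /\ z \notin [set a0]} &
    [/\ head d s \in near 1 [set x in b], last d s \in near 1 [set a0],
    {in s, forall z, z \in near 1 [set x in b] -> z = head d s} &
    {in s, forall z, z \in near 1 [set a0] -> z = last d s}]].
  apply: (@link _ d _ _ _ xb y0 cBMD) => //.
  - by rewrite !inE xbB.
  - by apply: (n1); rewrite inE.
  - by rewrite !inE y0D !orbT.
  - by move=> z /nb2 zB /na02 zD; far_absurd.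
have QbA x : x \in Qb -> x \in near 2 A -> False.
  by move/QbW; rewrite !inE -orbA => /or3P[] ? ?; far_absurd.
have QaB x : x \in Qa -> x \in near 2 B -> False.
  by move/QaW; rewrite !inE => /orP[] ? ?; far_absurd.
have QaD x : x \in Qa -> x \notin D by case/QaN.
have Qab_edge x y : x \in Qb -> y \in Qa -> edge x y -> x = last d Qb /\ y = a0.
  move=> xQ yQ xy; have ynear (X : {set G}) : x \in X -> y \in near 1 X.
    by move=> xX; apply: near_edge (near0 xX) xy.
  suff xD : x \in D.
    have Ey : y = a0 by rewrite (Qa_head _ yQ) ?ynear // EQa.
    split=> //; apply: Qb_last => //; apply: (near1_edge (set11 a0)).
    by rewrite -Ey.
  have := QbW _ xQ; rewrite !inE -orbA => /or3P[] // /ynear y1;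
    by move: (QaW _ yQ); rewrite inE => /orP[] y2; far_absurd.
have Qab x : x \in Qb -> x \notin Qa.
  move=> xQb; apply/negP => xQa; move: (QbW _ xQb) (QaW _ xQa).
  by rewrite !inE (negPf (QaD _ xQa)) orbF => /orP[] ? /orP[] ?; far_absurd.
pose Q := Qb ++ Qa.
have pQ : ipath Q.
  apply: (ipath_cat (d := d)) => // x y xQ yQ; apply/idP/andP.
    by rewrite EQa => /(Qab_edge _ _ xQ yQ)[-> ->].
  rewrite EQa /= => -[/eqP-> /eqP->]; apply/negPn/negP.
  have [] := near1P lQb; first by case: (QbN _ (mem_last_default d (ltnW Qb2))).
  by move=> z; rewrite inE => /eqP->; rewrite edge_sym => ->.
have hdQ : head d Q = head d Qb by rewrite head_cat_nonempty // ltnW.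
have lsQ : last d Q = last d Qa by rewrite last_cat_nonempty // ltnW.
have QW x : x \in Q -> x \in A :|: B :|: D :|: M :|: Q1 :|: Q2.
  rewrite mem_cat => /orP[/QbW|/QaW]; rewrite !inE.
    by case/orP=> [/orP[]|] ->; rewrite ?orbT.
  by case/orP=> ->; rewrite ?orbT.
pose C := b ++ q ++ a ++ p.
have QC x : x \in Q -> x \notin C.
  move=> xQ; apply/negP => xC; have := seen x x (QW _ xQ) xC; rewrite eqxx.
  case=> // [xa'|xb']; move: xQ; rewrite mem_cat => /orP[] xQ.
  - by apply: (QbA _ xQ); apply: (@nearW _ 1); rewrite ?aA.
  - by case: (QaN _ xQ) => _; rewrite inE xa'.
  - by case: (QbN _ xQ); rewrite inE xb'.
  - by apply: (QaB _ xQ); apply: (@nearW _ 1); rewrite ?bB.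
have Q_C x y : x \in Q -> y \in C -> edge x y ->
    x = head d Q /\ y \in b \/ x = last d Q /\ y \in a.
  rewrite hdQ lsQ => xQ yC xy.
  have [|yab|yab] := seen x y (QW _ xQ) yC; first by rewrite xy orbT.
    have x1 : x \in near 1 [set z in a].
      by apply: (near1_edge (x := y)); rewrite ?inE.
    right; split=> //; apply: Qa_last (x1).
    by move: xQ; rewrite mem_cat => /orP[/QbA/(_ (na2 _ x1))|].
  have x1 : x \in near 1 [set z in b].
    by apply: (near1_edge (x := y)); rewrite ?inE.
  left; split=> //; apply: Qb_head (x1).
  by move: xQ; rewrite mem_cat => /orP[|/QaB/(_ (nb2 _ x1))].
(* The ear may start next to [U] and end next to [V]. Here [a0] is counted with [Qb], being the only
   vertex of [Qa] within distance 1 of [D]. *)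
pose U := [set x in rcons Qb a0 | x \in near 1 D].
pose V := [set x in C ++ Qa | x \in near 1 A].
have nU2 x : x \in near 1 U -> x \in near 2 D.
  by apply: (@near_subset _ 1 1) => z; rewrite inE => /andP[].
have nV2 x : x \in near 1 V -> x \in near 2 A.
  by apply: (@near_subset _ 1 1) => z; rewrite inE => /andP[].
have [z5 /setIP[z5D z5Q]] := set0Pn _ DQ2.
have [z6 /setIP[z6A z6Q]] := set0Pn _ AQ2.
have cW : conn (A :|: Q2 :|: D).
  by apply: (connU (x := z5)) => //; [apply: (connU (x := z6))|rewrite inE z5Q orbT].
have a0U : a0 \in U by rewrite inE mem_rcons mem_head.
have [t [t2 tW pt tN [ht lt t_head t_last]]] :
    exists s, [/\ 2 <= size s, {subset s <= A :|: Q2 :|: D}, ipath s,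
    {in s, forall z, z \notin U /\ z \notin V} &
    [/\ head d s \in near 1 U, last d s \in near 1 V,
    {in s, forall z, z \in near 1 U -> z = head d s} &
    {in s, forall z, z \in near 1 V -> z = last d s}]].
  apply: (@link _ d _ _ _ y0 xa cW) => //.
  - by rewrite !inE y0D !orbT.
  - exact: near1_edge a0U ya0.
  - by rewrite !inE xaA.
  - by apply: (n1); rewrite inE mem_cat /C !mem_cat xaa !orbT n1.
  - by move=> z /nU2 zD /nV2 zA; far_absurd.
have t0 : 0 < size t by apply: ltnW.
have hdt : head d t \in t by rewrite mem_head_default.
have lst : last d t \in t by rewrite mem_last_default.
have Nhl : head d t != last d t.
  case: (pt) => Ut _; rewrite index_eq_last //.
  by case: (t) t2 => //= x s; rewrite eqxx; clia.
have tZ x : x \in t -> x \in A :|: B :|: D :|: M :|: Q1 :|: Q2.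
  by move/tW; rewrite !inE => /orP[/orP[]|] ->; rewrite ?orbT.
have toV x y : x \in t -> y \in V -> edge x y -> x = last d t.
  by move=> xt yV xy; apply: t_last (near1_edge yV xy).
have toU x y : x \in t -> y \in U -> edge x y -> x = head d t.
  by move=> xt yU xy; apply: t_head (near1_edge yU xy).
have tB x : x \in t -> x \in near 2 B -> False.
  by move/tW; rewrite !inE => /orP[/orP[]|] ? ?; far_absurd.
have aV x : x \in a -> x \in V.
  by move=> xa'; rewrite inE !mem_cat xa' !orbT aA.
have t_C x y : x \in t -> y \in C -> edge x y -> x = last d t /\ y \in a.
  move=> xt yC xy; case: (seen x y (tZ _ xt) yC); rewrite ?xy ?orbT // => yab.
    by split=> //; apply: (toV _ y) => //; apply: aV.
  exfalso; apply: (tB _ xt); apply: nb2.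
  by apply: (near1_edge (x := y)); rewrite ?inE.
have tC x : x \in t -> x \notin C.
  move=> xt; apply/negP => xC; have := seen x x (tZ _ xt) xC; rewrite eqxx.
  case=> // [/aV xV|/bB xB]; first by case: (tN _ xt); rewrite xV.
  exact: (tB _ xt (nearW _ xB)).
have t_Qb x y : x \in t -> y \in Qb -> edge x y -> x = head d t /\ y \in U.
  move=> xt yQ xy; suff yU : y \in U by split=> //; apply: (toU _ y).
  have yn (X : {set G}) : x \in X -> y \in near 1 X.
    by move=> xX; apply: near_edge (near0 xX) xy.
  rewrite inE mem_rcons inE yQ orbT /=.
  have := tW _ xt; rewrite !inE -orbA => /or3P[/yn y1|/yn y1|/yn//].
    by case: (QbA _ yQ); apply: nearW y1.
  by have := QbW _ yQ; rewrite !inE -orbA => /or3P[] ?;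
    [far_absurd|far_absurd|apply: n1].
have t_Qa x y : x \in t -> y \in Qa -> edge x y ->
    x = head d t /\ y = a0 \/ [/\ x = last d t, y \in V & y \in near 1 A].
  move=> xt yQ xy.
  have yn (X : {set G}) : x \in X -> y \in near 1 X.
    by move=> xX; apply: near_edge (near0 xX) xy.
  have yA1 : y \in near 1 A ->
      x = head d t /\ y = a0 \/ [/\ x = last d t, y \in V & y \in near 1 A].
    move=> yA; right; have yV : y \in V by rewrite inE mem_cat yQ orbT yA.
    by split=> //; apply: (toV _ y).
  have := tW _ xt; rewrite 2!in_setU -orbA => /or3P[/yn/yA1//|/yn y1|/yn y1].
    by have := QaW _ yQ; rewrite in_setU => /orP[/n1/yA1//|y2]; far_absurd.
  have Ey : y = a0 by rewrite (Qa_head _ yQ y1) EQa.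
  by left; split=> //; apply: (toU _ y) => //; rewrite Ey.
have tQ x : x \in t -> x \notin Q.
  move=> xt; have [xU xV] := tN _ xt; rewrite mem_cat negb_or.
  apply/andP; split; apply/negP => xQ.
    have := tW _ xt; rewrite !inE -orbA => /or3P[xA|xQ2|xD].
    - by apply: (QbA _ xQ); apply: nearW (near0 xA).
    - have := QbW _ xQ; rewrite !inE -orbA => /or3P[] ?; try far_absurd.
      by case/negP: xU; rewrite inE mem_rcons inE xQ orbT n1.
    - by case/negP: xU; rewrite inE mem_rcons inE xQ orbT n1.
  have xNA : x \notin A.
    by apply: contra xV => xA; rewrite inE mem_cat xQ orbT n1.
  have xND := QaD _ xQ; move: (tW _ xt) (QaW _ xQ).
  rewrite !inE (negPf xNA) (negPf xND) orbF /= => ? ?; far_absurd.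
have [I [b1 [b2 [Eb I0 [uh ul] nb1 nb2']]]] : exists I b1 b2, [/\ b = b1 ++ I ++ b2,
   0 < size I, edge (head d Q) (head d I) /\ edge (head d Q) (last d I),
   {in b1, forall x, ~~ edge (head d Q) x} &
   {in b2, forall x, ~~ edge (head d Q) x}].
  have [] := near1P hQb; first by case: (QbN _ (mem_head_default d (ltnW Qb2))).
  move=> x; rewrite inE => xb1 xe.
  have [|s1 [s2 [s3 H]]] := @hull _ d (edge (head d Q)) b.
    by apply/hasP; exists x; rewrite // hdQ edge_sym.
  by exists s2, s1, s3.
have [I' [a1 [a2 [Ea I'0 [uh' ul'] na1 na2']]]] : exists I a1 a2, [/\ a = a1 ++ I ++ a2,
   0 < size I, edge (last d Q) (head d I) /\ edge (last d Q) (last d I),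
   {in a1, forall x, ~~ edge (last d Q) x} &
   {in a2, forall x, ~~ edge (last d Q) x}].
  have [] := near1P lQa; first by case: (QaN _ (mem_last_default d (ltnW Qa2))).
  move=> x; rewrite inE => xb1 xe.
  have [|s1 [s2 [s3 H]]] := @hull _ d (edge (last d Q)) a.
    by apply/hasP; exists x; rewrite // lsQ edge_sym.
  by exists s2, s1, s3.
have [J [X [Y [EJ J0 [th tl] nX nY]]]] : exists J X Y, [/\ rcons Qb a0 = X ++ J ++ Y,
   0 < size J, edge (head d t) (head d J) /\ edge (head d t) (last d J),
   {in X, forall x, ~~ edge (head d t) x} & {in Y, forall x, ~~ edge (head d t) x}].
  have [] := near1P ht; first by case: (tN _ hdt).
  move=> x xU xe.
  have [|s1 [s2 [s3 H]]] := @hull _ d (edge (head d t)) (rcons Qb a0).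
    by apply/hasP; exists x; rewrite 1?edge_sym //; case/setIdP: xU.
  by exists s2, s1, s3.
pose Z := Y ++ Qa'.
have EQ : Q = X ++ J ++ Z by rewrite /Q EQa -cat_rcons EJ /Z -!catA.
have EC z : (z \in I ++ (b2 ++ q ++ a1) ++ I' ++ (a2 ++ p ++ b1)) = (z \in C).
  by rewrite /C Eb Ea !mem_cat; do !case: (z \in _).
have Q0 : 0 < size Q by rewrite size_cat; clia.
have inQ x : x \in rcons Qb a0 -> x \in Q.
  by rewrite mem_rcons inE mem_cat => /predU1P[->|->//]; rewrite a0Qa orbT.
have JQ x : x \in J -> x \in rcons Qb a0 by rewrite EJ !mem_cat => ->; rewrite orbT.
have hdJ : head d J \in U.
  have hJ : head d J \in J by rewrite mem_head_default.
  have := JQ _ hJ; rewrite mem_rcons inE => /predU1P[->//|hQ].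
  by case: (t_Qb _ _ hdt hQ th).
have a0NA : a0 \notin near 1 A by apply/negP => a0A; far_absurd.
have QbaA x : x \in rcons Qb a0 -> x \notin near 1 A.
  rewrite mem_rcons inE => /predU1P[->//|xQ]; apply/negP => xA.
  exact: (QbA _ xQ (nearW _ xA)).
(* [X] leads from near [B] to near [D], and [Z] from near [D] to near [A]; the bound 30 leaves room
   for the radii lost at the ends. *)
have X20 : 20 <= size X.
  have [J' EJ'] : exists J', J = head d J :: J'.
    by case: (J) J0 => // x s _; exists s.
  have pX : ipath (rcons X (head d J)).
    apply: (@ipath_infix _ [::] _ (J' ++ Z)).
    by rewrite /= cat_rcons -cat_cons -EJ' -EQ.
  have hX : head d (rcons X (head d J)) = head d Q.
    by rewrite EQ EJ'; case: (X).
  have := far_ipath (d := d) (a := 2) (b := 1) FBD pX.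
  rewrite size_rcons last_rcons hX hdQ => /(_ isT (nb2 _ hQb)).
  by case/setIdP: hdJ => _ hJD /(_ hJD); clia.
have Z20 : 20 <= size Z.
  have := far_ipath (far_sym FAD) pQa (ltnW Qa2) hQa (na2 _ lQa).
  by rewrite /Z EQa size_cat /=; clia.
have pQJ : ipath (X ++ J ++ Z) by rewrite -EQ.
have bC x : x \in b -> x \in C by rewrite /C !mem_cat => ->.
have NV x : x \in C -> edge (last d t) x -> x \in a.
  by move=> xC e; case: (t_C _ _ lst xC e).
have bNA x : x \in b -> x \notin a.
  by move/bB => xB; apply/negP => /aA xA; far_absurd.
have qNA x : x \in q -> x \notin a.
  by case/qP => _ xN _; apply: contra xN; apply: aA.
have pNA x : x \in p -> x \notin a.
  by case/pP => _ xN _; apply: contra xN; apply: aA.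
(* [ear_near_end] denies any neighbour of [last d t] in [Z] or on the hole outside [I], whereas [t]
   was built to end next to [V]. *)
suff: has (edge (last d t)) (Z ++ (b2 ++ q ++ a1) ++ I' ++ (a2 ++ p ++ b1)).
  apply/negP; apply: (ear_near_end holes_l (I1 := I) (X := X) (J := J)) => //.
  - move: hC; rewrite Eb Ea -!catA => /hole_catC.
    by rewrite -!catA.
  - by rewrite !size_cat; clia.
  - by rewrite !size_cat; clia.
  - by move=> x; rewrite EC -EQ => /QC.
  - rewrite -EQ; split=> // x y xQ; rewrite EC => yC xy.
    case: (Q_C _ _ xQ yC xy) => -[Ex yab]; [left|right]; split=> //.
      move: yab; rewrite Eb !mem_cat => /or3P[/nb1|//|/nb2']; by rewrite -Ex xy.
    move: yab; rewrite Ea !mem_cat => /or3P[/na1|//|/na2']; by rewrite -Ex xy.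
  - by move=> x xt; rewrite EC tC.
  - by move=> x xt; rewrite -EQ tQ.
  - rewrite -EQ => x y xt yQ xy.
    have inJ : x = head d t -> y \in rcons Qb a0 -> y \in J.
      by move=> Ex; rewrite EJ !mem_cat => /or3P[/nX|//|/nY]; rewrite -Ex xy.
    move: (yQ); rewrite mem_cat => /orP[yQb|yQa].
      have [Ex _] := t_Qb _ _ xt yQb xy; left; split=> //; apply: inJ => //.
      by rewrite mem_rcons inE yQb orbT.
    case: (t_Qa _ _ xt yQa xy) => [[Ex Ey]|[Ex _ yA]].
      by left; split=> //; apply: inJ; rewrite // Ey mem_rcons mem_head.
    right; split=> //; rewrite mem_cat; move: yQa; rewrite EQa inE.
    by case/predU1P=> [Ey|->]; [rewrite -Ey yA in a0NA|rewrite orbT].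
  - move=> x y xt; rewrite EC => yC xy; have [Ex ya] := t_C _ _ xt yC xy.
    split=> //; move: ya; rewrite Ea !mem_cat.
    by case/or3P=> ->; rewrite ?orbT.
  (* A neighbour of [last d t] on [Q] is near [A], hence not in [rcons Qb a0]. So [Y] is empty and
     [head d Z] follows [a0] on [Qa], which puts it within distance 2 of [D]. *)
  - apply/negP => vZ; have Z0 : 0 < size Z by clia.
    have hZ := mem_head_default d Z0.
    have hZA : head d Z \in near 1 A.
      have hZQ : head d Z \in Q by rewrite EQ 2!mem_cat hZ !orbT.
      move: (hZQ); rewrite mem_cat => /orP[/(t_Qb _ _ lst)/(_ vZ)[E _]|].
        by rewrite -E eqxx in Nhl.
      by case/(t_Qa _ _ lst)/(_ vZ) => [[E _]|[]//]; rewrite -E eqxx in Nhl.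
    have [Y0|Y0] := posnP (size Y); last first.
      have /QbaA : head d Z \in rcons Qb a0.
        by rewrite EJ !mem_cat /Z head_cat_nonempty // mem_head_default ?orbT.
      by rewrite hZA.
    have Qa'0 : 0 < size Qa' by move: Qa2; rewrite EQa.
    have e : edge a0 (head d Z).
      rewrite /Z (size0nil Y0); have := @ipath_edge _ d Qa 0 pQa Qa2.
      by rewrite EQa /=; case: (Qa') Qa'0.
    by have h2 := near_edge a0D e; far_absurd.
  - have h : head d (b2 ++ q ++ a1) \in b2 ++ q.
      by rewrite catA head_cat_nonempty ?mem_head_default // size_cat; clia.
    apply/negP => /NV; rewrite -EC !mem_cat; move: h; rewrite mem_cat.
    case/orP=> hh; rewrite hh ?orbT => /(_ isT); apply/negP; last exact: qNA.
    by apply: bNA; rewrite Eb !mem_cat hh !orbT.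
  - have h : last d (a2 ++ p ++ b1) \in p ++ b1.
      by rewrite last_cat_nonempty ?mem_last_default // size_cat; clia.
    apply/negP => /NV; rewrite -EC !mem_cat; move: h; rewrite mem_cat.
    case/orP=> hh; rewrite hh ?orbT => /(_ isT); apply/negP; first exact: pNA.
    by apply: bNA; rewrite Eb !mem_cat hh.
have [x xV] := near1P lt (proj2 (tN _ lst)); rewrite edge_sym => xe.
apply/hasP; exists x; rewrite // mem_cat.
have [xC|xNC] := boolP (x \in C).
  have := NV _ xC xe; rewrite Ea !mem_cat.
  by case/or3P=> ->; rewrite ?orbT.
have xQa : x \in Qa by move: xV; rewrite inE mem_cat (negPf xNC) => /andP[].
case: (t_Qa _ _ lst xQa xe) => [[E]|[_ _ xA]]; first by rewrite E eqxx in Nhl.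
move: xQa; rewrite EQa inE /Z mem_cat => /predU1P[Ex|->]; last by rewrite orbT.
by rewrite -Ex xA in a0NA.
Qed.

End Fan.

Lemma monoholed_no_fan G A B D P1 P2 M Q1 Q2 : @monoholed G ->
  ~ @fan G 30 A B D P1 P2 M Q1 Q2.
Proof.
move=> [l lG] F; have [/set0Pn[d _] _ _ _] := fan_AB_meet F.
exact: (no_fan d lG F).
Qed.

(** * From fat minor models of [U4] to fans *)

Section FatMinors.
Variable G : sgraph.
Implicit Types (X Y : {set G}).

Lemma far_dist_geq K X Y : dist_geq K X Y -> far K X Y.
Proof.
move=> F x y p xX yY; case/shortenP=> q pq Uq qp lq.
apply: leq_trans (F x y q xX yY _) _; first by rewrite /is_path pq Uq lq eqxx.
by apply: uniq_leq_size => //; case/andP: Uq.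
Qed.

Lemma farUl K X X' Y : far K X Y -> far K X' Y -> far K (X :|: X') Y.
Proof. by move=> F F' x y p /setUP[xX|xX]; [apply: F|apply: F']. Qed.

Lemma farUr K X X' Y : far K Y X -> far K Y X' -> far K Y (X :|: X').
Proof. by move=> F F' x y p xY /setUP[yX|yX]; [apply: F|apply: F']. Qed.

Lemma conn_subgraph (X : subgraph G) :
  connected_subgraph X -> conn (sub_vertices X).
Proof.
case=> _ cX x y xX yX; apply: connect_sub (cX x y xX yX) => a b ab.
by apply: connect1; have [aX bX e] := sub_edgeP ab; rewrite /= aX bX.
Qed.

Definition rim i (lti : i < 4) : U4 := Some (Ordinal lti).

(** The apex becomes [A], and the inner path vertices [r1] and [r2] become [B] and [D]. The branch
    sets of the end vertices [r0] and [r3] are merged with their incident edge sets into the links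
    [P1] and [Q2]. *)
Lemma U4_fat_minor_fan K : fat_minor K U4 G ->
  exists A B D P1 P2 M Q1 Q2, @fan G K A B D P1 P2 M Q1 Q2.
Proof.
case=> B [P [cB cP inc BB PP BP]].
pose a : U4 := None.
pose r0 : U4 := rim (isT : 0 < 4); pose r1 : U4 := rim (isT : 1 < 4).
pose r2 : U4 := rim (isT : 2 < 4); pose r3 : U4 := rim (isT : 3 < 4).
pose b v := sub_vertices (B v); pose p u v := sub_vertices (P [set u; v]).
have in_edges (u v : U4) : edge u v -> [set u; v] \in edges U4.
  move=> uv; rewrite inE; apply/existsP; exists u.
  by apply/existsP; exists v; rewrite uv eqxx.
have cb v : conn (b v) by apply: conn_subgraph.
have cp (u v : U4) : edge u v -> conn (p u v).
  by move=> uv; apply/conn_subgraph/cP/in_edges.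
have bb (u v : U4) : u != v -> far K (b u) (b v) by move=> uv; apply/far_dist_geq/BB.
have bp (w u v : U4) : edge u v -> w != u -> w != v -> far K (b w) (p u v).
  move=> uv wu wv; apply/far_dist_geq/BP; first exact: in_edges.
  by rewrite !inE negb_or wu.
have pp (u v w z : U4) : edge u v -> edge w z ->
    (u != w) && (u != z) || (v != w) && (v != z) ->
    far K (p u v) (p w z).
  move=> uv wz ne; apply/far_dist_geq/PP; try exact: in_edges.
  apply: contraTneq ne => E; rewrite negb_or !negb_and !negbK.
  by rewrite -!in_set2 -E !inE !eqxx orbT.
have mtl (u v : U4) : edge u v -> b u :&: p u v != set0.
  by move=> uv; apply: inc; rewrite ?in_edges // !inE eqxx.
have mtr (u v : U4) : edge u v -> b v :&: p u v != set0.
  by move=> uv; apply: inc; rewrite ?in_edges // !inE eqxx orbT.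
exists (b a), (b r1), (b r2), (p a r0 :|: b r0 :|: p r0 r1).
exists (p a r1), (p r1 r2), (p a r2).
exists (p a r3 :|: b r3 :|: p r3 r2).
have cU3 (u v w : U4) : edge u v -> edge v w -> conn (p u v :|: b v :|: p v w).
  move=> uv vw; have [x /setIP[xb xp]] := set0Pn _ (mtr _ _ uv).
  have [y /setIP[yb yp]] := set0Pn _ (mtl _ _ vw).
  apply: (connU (x := y)); rewrite ?inE ?yb ?orbT //; last exact: cp.
  by apply: (connU (x := x)) => //; apply: cp.
have meetUl X Y Z : X :&: Y != set0 -> X :&: (Y :|: Z) != set0.
  by move=> /set0Pn[x /setIP[xX xY]]; apply/set0Pn; exists x; rewrite !inE xX xY.
have meetUr X Y Z : X :&: Z != set0 -> X :&: (Y :|: Z) != set0.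
  by rewrite setUC; apply: meetUl.
split.
- by split; split=> //; (apply: cp || apply: cU3).
- split; [exact: meetUl (meetUl _ _ _ (mtl a r0 isT))|exact: mtl|
          exact: meetUr (mtr r0 r1 isT)|exact: mtr].
- split; [exact: mtl|exact: meetUl (meetUl _ _ _ (mtl a r3 isT))|exact: mtr|
          exact: meetUr (mtr r3 r2 isT)].
- by split; [apply: mtl|apply: mtr].
- by split; apply: bb.
- by split; do ?apply: farUr; do ?[exact: bp | exact: bb].
- by split; do ?apply: farUl; do ?apply: farUr;
    do ?[exact: pp | exact: bb | exact: bp | apply: far_sym; exact: bp].
- by split; do ?apply: farUl; do ?apply: farUr;
    do ?[exact: pp | exact: bb | exact: bp | apply: far_sym; exact: bp].
- by split; do ?apply: farUl; do ?apply: farUr;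
    do ?[exact: pp | exact: bb | exact: bp | apply: far_sym; exact: bp].
Qed.
End FatMinors.

(** * Covering geodesics by rooted geodesics *)

Section Metric.
Variable G : sgraph.
Hypothesis cG : forall x y : G, connect (@edge G) x y.
Implicit Types (x y z : G) (p q : seq G) (X Y : {set G}).

Lemma walk_near x p : path (@edge G) x p -> last x p \in near (size p) [set x].
Proof.
elim/last_ind: p => [|p y IH] /=; first by rewrite near0 ?set11.
rewrite rcons_path last_rcons size_rcons => /andP[/IH pp e].
exact: near_edge pp e.
Qed.

Lemma ex_near x y : exists n, y \in near n [set x].
Proof.
by have /connectP[p pp ->] := cG x y; exists (size p); apply: walk_near.
Qed.

Definition dist x y := ex_minn (ex_near x y).

Lemma dist_walk x p y : path (@edge G) x p -> last x p = y -> dist x y <= size p.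
Proof.
move=> pp <-; rewrite /dist; case: ex_minnP => n _; apply; exact: walk_near.
Qed.

Lemma ex_geodesic x y :
  exists p, [/\ path (@edge G) x p, last x p = y & size p = dist x y].
Proof.
have [_ [p [/set1P-> pp lp sp]]] : exists x' p, [/\ x' \in [set x],
    path (@edge G) x' p, last x' p = y & size p <= dist x y].
  by apply: near_walk; rewrite /dist; case: ex_minnP.
by exists p; split=> //; apply/eqP; rewrite eqn_leq sp dist_walk.
Qed.

Lemma dist_sym x y : dist x y = dist y x.
Proof.
suff le a b : dist a b <= dist b a by apply/eqP; rewrite eqn_leq !le.
have [p [pp lp <-]] := ex_geodesic b a; have [q [pq lq <- _]] := rev_walk pp lp.
exact: dist_walk.
Qed.

Lemma dist_triangle y x z : dist x z <= dist x y + dist y z.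
Proof.
have [p [pp lp <-]] := ex_geodesic x y; have [q [pq lq <-]] := ex_geodesic y z.
rewrite -size_cat; apply: dist_walk; first by rewrite cat_path pp lp.
by rewrite last_cat lp.
Qed.

Lemma dist_edge x y : edge x y -> dist x y <= 1.
Proof. by move=> e; apply: (@dist_walk x [:: y]); rewrite //= e. Qed.

Lemma dist0 x : dist x x = 0.
Proof. by apply/eqP; rewrite -leqn0; apply: (@dist_walk x [::]). Qed.

Lemma isometric_dist x p : isometric_path x p -> size p = dist x (last x p).
Proof.
move=> [/and3P[pp _ _] min_p]; apply/eqP; rewrite eqn_leq dist_walk // andbT.
have [q [pq lq <-]] := ex_geodesic x (last x p).
case/shortenP: pq lq => r pr Ur rq lr.
apply: leq_trans (min_p r _) (uniq_leq_size _ rq); last by case/andP: Ur.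
by rewrite /is_path pr Ur lr eqxx.
Qed.

Lemma dist_isometric x p : path (@edge G) x p -> size p = dist x (last x p) ->
  isometric_path x p.
Proof.
move=> pp sp; split; last first.
  by move=> q /and3P[pq _ /eqP lq]; rewrite sp; apply: dist_walk.
rewrite /is_path pp eqxx andbT /=; case/shortenP: pp sp => q pq Uq qp sp.
have sq : size p <= size q by rewrite sp; apply: dist_walk.
suff: uniq (x :: p) by [].
apply: (leq_size_uniq Uq) => // z.
by rewrite !inE => /predU1P[->|/qp->]; rewrite ?eqxx ?orbT.
Qed.

(** * A geodesic seen from a root *)

Section Geodesic.
Variables (u : nat -> G) (N : nat) (v : G).
Hypothesis u_edge : forall i, i < N -> edge (u i) (u i.+1).
Hypothesis u_dist : forall i j, i <= j <= N -> dist (u i) (u j) = j - i.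
Let f i := dist v (u i).

Lemma subwalk i j : i <= j <= N -> exists q,
  [/\ path (@edge G) (u i) q, last (u i) q = u j, size q = j - i &
      forall z, z \in u i :: q <-> exists2 k, i <= k <= j & z = u k].
Proof.
elim: j => [|j IH] /andP[ij jN].
  have -> : i = 0 by lia.
  exists [::]; split=> // z; rewrite inE; split=> [/eqP->|[k k0 ->]].
    by exists 0.
  by have -> : k = 0 by lia.
have [Eij|Nij] := eqVneq i j.+1.
  exists [::]; rewrite Eij subnn; split=> // z; rewrite inE.
  split=> [/eqP->|[k kj ->]]; first by exists j.+1; rewrite ?leqnn.
  by have -> : k = j.+1 by lia.
have [|q [pq lq sq qP]] := IH; first by lia.
exists (rcons q (u j.+1)); split.
- by rewrite rcons_path pq lq u_edge.
- by rewrite last_rcons.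
- by rewrite size_rcons sq; lia.
- move=> z; rewrite -rcons_cons mem_rcons inE; split.
    case/predU1P=> [->|/qP[k kj ->]]; first by exists j.+1; rewrite ?leqnn ?ij.
    by exists k => //; lia.
  case=> k kj ->; have [->|Nkj] := eqVneq k j.+1; first by rewrite eqxx.
  by apply/orP; right; apply/qP; exists k => //; lia.
Qed.

Lemma f_lip i j : i <= j <= N -> f i <= f j + (j - i) /\ f j <= f i + (j - i).
Proof.
move=> ij; rewrite -(u_dist ij); split; last exact: dist_triangle.
by rewrite (dist_sym (u i)); apply: dist_triangle.
Qed.

Definition covered lo hi n := exists qs : seq (seq G),
  [/\ size qs <= n, {in qs, forall q, isometric_path v q} &
      forall i, lo <= i <= hi -> exists2 q, q \in qs & u i \in v :: q].

(** A geodesic from [v] to [a] followed by [r] is again a geodesic, as its length is the distance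
    from [v] to [b]. *)
Lemma covered_walk a b r i k : path (@edge G) a r -> last a r = b ->
    dist v b = dist v a + size r ->
    (forall j, i <= j <= k -> u j \in a :: r) -> covered i k 1.
Proof.
move=> pr lr db ur; have [p [pp lp sp]] := ex_geodesic v a.
exists [:: p ++ r]; split=> // [q|j /ur uj].
  rewrite inE => /eqP->; apply: dist_isometric; first by rewrite cat_path pp lp.
  by rewrite last_cat lp lr size_cat sp db.
exists (p ++ r); first exact: mem_head.
move: uj; rewrite -cat_cons mem_cat inE => /predU1P[->|->]; last by rewrite orbT.
by rewrite -lp mem_last.
Qed.

Lemma covered_monotone i k : i <= k <= N ->
  f k = f i + (k - i) \/ f i = f k + (k - i) -> covered i k 1.
Proof.
move=> ik fik; have [q [pq lq sq qP]] := subwalk ik.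
have uq j : i <= j <= k -> u j \in u i :: q by move=> ij; apply/qP; exists j.
case: fik => fik; first by apply: (covered_walk pq lq); rewrite // sq.
have [r [pr lr sr rq]] := rev_walk pq lq.
by apply: (covered_walk pr lr) => [|j /uq]; rewrite ?sr ?sq // rq.
Qed.

Lemma covered_cat i j k m n : covered i j m -> covered j.+1 k n ->
  covered i k (m + n).
Proof.
move=> [qs [sq iq cq]] [rs [sr ir cr]]; exists (qs ++ rs); split.
- by rewrite size_cat leq_add.
- by move=> q; rewrite mem_cat => /orP[/iq|/ir].
- move=> a /andP[ia ak]; have [aj|ja] := leqP a j.
    by have [|q qq uq] := cq a; [rewrite ia|exists q; rewrite // mem_cat qq].
  by have [|q qq uq] := cr a; [rewrite ja|exists q; rewrite // mem_cat qq orbT].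
Qed.

Lemma coveredW i k m n : m <= n -> covered i k m -> covered i k n.
Proof. by move=> mn [qs [sq iq cq]]; exists qs; split=> //; apply: leq_trans mn. Qed.

(* A maximal run on which [phi] is constant is covered by one rooted path, so
   the number of paths is the number of values of [phi]. *)
Lemma covered_potential (phi : nat -> nat) :
    (forall i k, i <= k <= N -> phi i <= phi k) ->
    (forall i k, i <= k <= N -> phi i = phi k -> covered i k 1) ->
  forall m i k, i <= k <= N -> phi k <= phi i + m -> covered i k m.+1.
Proof.
move=> mono cov; elim=> [|m IH] i k ik phik.
  by apply: cov => //; have := mono _ _ ik; lia.
have exi : exists j, (i <= j <= k) && (phi j == phi i).
  by exists i; rewrite leqnn eqxx; case/andP: ik => ->.
have [|j /andP[/andP[ij jk] /eqP phij] max_j] := ex_maxnP exi (m := k).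
  by move=> j /andP[/andP[]].
have cij : covered i j 1 by apply: cov; rewrite ?phij //; lia.
have [Ejk|Njk] := eqVneq j k; first by rewrite -Ejk; apply: coveredW cij.
have phij1 : phi j.+1 != phi i.
  by apply/negP => E; have := max_j j.+1; rewrite E; lia.
have phi_ij1 : phi i <= phi j.+1 by apply: mono; lia.
rewrite -[m.+2]add1n; apply: covered_cat cij (IH _ _ _ _); lia.
Qed.

(* Both [i - f i] and [i + f i] grow by at least [W] from [i] to [j]. *)
Definition rel_apart W : rel nat := fun i j =>
  [&& i < j, i + f j + W <= j + f i & i + f i + W <= j + f j].

(** One of the two potentials grows by less than [W]. Where it is constant, [f] has slope 1 or -1,
    so one rooted path covers the run. *)
Lemma covered_close W i k : 0 < W -> i <= k <= N -> ~~ rel_apart W i k ->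
  covered i k W.
Proof.
case: W => // W _ ik nap.
have le_f0 j : j <= N -> f j <= f 0 + j.
  by move=> jN; have [_] := @f_lip 0 j jN; rewrite subn0.
have [hi|lo] := leqP (k + f k) (i + f i + W).
  apply: (@covered_potential (fun j => j + f j)) => // a b ab.
    by have := f_lip ab; lia.
  by move=> E; apply: covered_monotone => //; right; lia.
(* Adding [f 0] makes the subtraction in [nat] exact. *)
apply: (@covered_potential (fun j => (f 0 + j) - f j)) => // [a b ab|a b ab E|].
- by have := f_lip ab; have := le_f0 a; have := le_f0 b; lia.
- apply: covered_monotone => //; left; have := le_f0 a; have := le_f0 b.
  by have := f_lip ab; lia.
- have := le_f0 i; have := le_f0 k; have := f_lip ik.
  move: nap; rewrite /rel_apart; lia.
Qed.

Lemma chain_or_covered W t i : 0 < W -> i <= N ->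
  (exists c, [/\ size c = t, path (rel_apart W) i c & all (leq^~ N) c]) \/
  covered i N (t * W).
Proof.
move=> W0; elim: t i => [|t IH] i iN; first by left; exists [::].
have [/hasP[j0 j0N apj0]|/hasPn none] := boolP (has (rel_apart W i) (iota 0 N.+1)).
  have exj : exists j, (j <= N) && rel_apart W i j.
    by exists j0; rewrite apj0; move: j0N; rewrite mem_iota; lia.
  case: (ex_minnP exj) => j /andP[jN apj] min_j.
  have cov1 : covered i j.-1 W.
    have ij : i < j by case/and3P: apj.
    apply: covered_close => //; first by lia.
    apply/negP => ap; have := min_j j.-1; rewrite ap andbT; lia.
  have [[c [sc pc Nc]]|cov2] := IH j jN.
    by left; exists (j :: c); split; rewrite /= ?sc ?apj ?pc ?jN.
  right; rewrite mulSn; apply: covered_cat cov1 _.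
  by have -> : j.-1.+1 = j by case/and3P: apj; lia.
right; apply: coveredW (covered_close W0 _ (none N _)).
- by rewrite mulSn leq_addr.
- by rewrite iN leqnn.
- by rewrite mem_iota; lia.
Qed.

Variable K : nat.
Hypothesis K0 : 0 < K.

(* The point at which a geodesic from [v] to [u i] first comes within [K] of
   the geodesic [u]. *)
Definition projects i y q m := [/\ path (@edge G) v q, last v q = y,
  forall z k, z \in v :: q -> k <= N -> K <= dist z (u k),
  m <= N /\ dist y (u m) = K & dist v y + dist y (u i) = f i].

Lemma ex_projection i : i <= N -> (forall k, k <= N -> K < f k) ->
  exists y q m, projects i y q m.
Proof.
move=> iN farv; have [p [pp lp sp]] := ex_geodesic v (u i).
pose near_u z := has (fun k => dist z (u k) <= K) (iota 0 N.+1).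
have near_uP z k : k <= N -> ~~ near_u z -> K < dist z (u k).
  by move=> kN /hasPn/(_ k) h; rewrite ltnNge; apply: h; rewrite mem_iota; lia.
have nearp : has near_u p.
  have nui : near_u (u i).
    by apply/hasP; exists i; rewrite ?dist0 // mem_iota; lia.
  apply/hasP; exists (u i) => //; have := mem_last v p; rewrite lp inE.
  by case/predU1P=> // E; have := farv _ iN; rewrite /f -E dist0.
case/split_find: nearp pp lp sp => y p1 p2 /hasP[m]; rewrite mem_iota => mN ym np1.
rewrite cat_path last_rcons last_cat last_rcons size_cat => /andP[p1y yp2] l2 sp.
have np1v z : z \in v :: p1 -> ~~ near_u z.
  rewrite inE => /predU1P[->|zp1].
    apply/hasPn => k; rewrite mem_iota => kN; rewrite -ltnNge; apply: farv; lia.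
  by apply: contra np1 => nz; apply/hasP; exists z.
have y_far k : k <= N -> K <= dist y (u k).
  move=> kN; move: p1y; rewrite rcons_path => /andP[_ /dist_edge e].
  have := near_uP _ _ kN (np1v _ (mem_last v p1)).
  move: (dist_triangle y (last v p1) (u k)) => tri /leq_trans/(_ tri) h.
  by rewrite -ltnS; apply: leq_trans h _; rewrite -add1n leq_add2r.
exists y, (rcons p1 y), m; split=> //.
- by rewrite last_rcons.
- move=> z k; rewrite -rcons_cons mem_rcons inE => /predU1P[->|zp1].
    exact: y_far.
  by move=> kN; apply: ltnW; apply: near_uP (np1v _ zp1).
- have mN' : m <= N by lia.
  by split=> //; apply/eqP; rewrite eqn_leq ym y_far.
- have := dist_triangle y v (u i); rewrite -/(f i).
  have := dist_walk p1y (last_rcons _ _ _); have := dist_walk yp2 l2.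
  by rewrite /f; lia.
Qed.

(** Going to [u i] through [u m] costs at most [2 * K] more than [f i]. For [m > i] this gives
    [m + f m <= i + f i + 2 * K], so [8 * K] of the growth of this potential up to [j] remains after
    [m]; its slope is at most 2, hence [4 * K]. *)
Lemma projection_before i j y q m : i <= N -> j <= N -> projects i y q m ->
  rel_apart (10 * K) i j -> m + 4 * K <= j.
Proof.
move=> iN jN [_ _ _ [mN ym] vy] /and3P[ij low high].
have := dist_triangle y v (u m); have := dist_triangle y (u m) (u i).
rewrite (dist_sym (u m) y) ym -/(f m) => t1 t2.
have [mi|im] := leqP m i.
  by have [|? ?] := @f_lip i j; lia.
move: t1; rewrite (dist_sym (u m)) u_dist ?(ltnW im) // => t1.
have [mj|jm] := leqP m j; first by have [|? ?] := @f_lip m j; lia.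
by have [|? ?] := @f_lip j m; lia.
Qed.

(** Mirror image of [projection_before], with the potential [k - f k] in place of [k + f k]. *)
Lemma projection_after i j y q m : i <= N -> j <= N -> projects j y q m ->
  rel_apart (10 * K) i j -> i + 4 * K <= m.
Proof.
move=> iN jN [_ _ _ [mN ym] vy] /and3P[ij low high].
have := dist_triangle y v (u m); have := dist_triangle y (u m) (u j).
rewrite (dist_sym (u m) y) ym -/(f m) => t1 t2.
have [jm|mj] := leqP j m.
  by have [|? ?] := @f_lip i j; lia.
move: t1; rewrite u_dist ?(ltnW mj) // => t1.
have [im|mi] := leqP i m; first by have [|? ?] := @f_lip i m; lia.
by have [|? ?] := @f_lip m i; lia.
Qed.

(** If [u k] were within [K] of [v], then [j - f j] would vary by at most [2 * K] over [j >= k], and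
    [j + f j] over [j <= k]. One of the two steps of the chain lies on one side of [k] and needs
    growth [10 * K]. *)
Lemma chain_far i0 i1 i2 : i2 <= N ->
  rel_apart (10 * K) i0 i1 -> rel_apart (10 * K) i1 i2 ->
  forall k, k <= N -> K < f k.
Proof.
move=> i2N /and3P[i01 l1 h1] /and3P[i12 l2 h2] k kN.
rewrite ltnNge; apply/negP => vk.
have tri j : f j <= K + dist (u k) (u j).
  by apply: leq_trans (dist_triangle (u k) v (u j)) _; rewrite leq_add2r.
have tri' j : dist (u k) (u j) <= K + f j.
  apply: leq_trans (dist_triangle v (u k) (u j)) _.
  by rewrite leq_add2r dist_sym.
have [ki|ik] := leqP k i1.
  have := tri i1; have := tri' i2; rewrite !u_dist; lia.
have := tri' i0; have := tri i1; rewrite !(dist_sym (u k)) !u_dist; lia.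
Qed.

Definition seg lo hi : {set G} :=
  [set z | has (fun k => z == u k) (iota lo (hi - lo).+1)].

Lemma segP lo hi z : lo <= hi ->
  z \in seg lo hi <-> exists2 k, lo <= k <= hi & z = u k.
Proof.
move=> lh; rewrite inE; split.
  by case/hasP=> k; rewrite mem_iota => kl /eqP->; exists k => //; lia.
by case=> k kl ->; apply/hasP; exists k; rewrite // mem_iota; lia.
Qed.

Lemma conn_seg lo hi : lo <= hi <= N -> conn (seg lo hi).
Proof.
move=> lh; have [q [pq _ _ qP]] := subwalk lh.
have -> : seg lo hi = [set z in u lo :: q]; last exact: conn_walk.
apply/setP=> z; rewrite in_set; have lh' : lo <= hi by lia.
by apply/idP/idP => [/(segP _ lh')/qP|/qP/(segP _ lh')].
Qed.

Definition loc a lo hi X := forall z, z \in X ->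
  exists k, [/\ lo <= k <= hi, k <= N & dist z (u k) <= a].

Lemma loc_seg lo hi : lo <= hi <= N -> loc 0 lo hi (seg lo hi).
Proof.
move=> lh z /segP[|k kl ->]; first by lia.
by exists k; rewrite dist0; split=> //; lia.
Qed.

Lemma loc_walk y w m : m <= N -> path (@edge G) y w -> last y w = u m ->
  size w = K -> loc K m m [set z in y :: w].
Proof.
move=> mN pw lw sw z; rewrite inE => zw; exists m; rewrite leqnn; split=> //.
rewrite -sw -lw; elim: w y pw zw {lw sw} => [|a w IH] y /=.
  by rewrite inE => _ /eqP->; rewrite dist0.
case/andP=> ya pw; rewrite inE => /predU1P[->|/(IH _ pw) le].
  apply: (@dist_walk _ (a :: w)); rewrite //= ya; exact: pw.
exact: leqW.
Qed.

Lemma locU a lo hi X Y : loc a lo hi X -> loc a lo hi Y -> loc a lo hi (X :|: Y).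
Proof. by move=> lX lY z /setUP[/lX|/lY]. Qed.

Lemma locW a lo hi b lo' hi' X : a <= b -> lo' <= lo -> hi <= hi' ->
  loc a lo hi X -> loc b lo' hi' X.
Proof. by move=> ab ll hh lX z /lX[k [kl kN zk]]; exists k; split=> //; lia. Qed.

Lemma far_loc a lo hi X b lo' hi' Y : loc a lo hi X -> loc b lo' hi' Y ->
  hi + a + b + K <= lo' -> far K X Y.
Proof.
move=> lX lY gap x y p /lX[k [kl kN xk]] /lY[k' [kl' kN' yk]] pp lp.
have := dist_walk pp lp; have := dist_triangle x (u k) (u k').
have := dist_triangle y x (u k').
rewrite (dist_sym (u k) x) u_dist; last by lia.
by move: xk yk kl kl' gap; clear; lia.
Qed.

(** Every other index is projected, and the skipped indices keep the projections [8 * K] apart. The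
    truncated geodesics from [v] form the apex and stay at distance at least [K] from [u]; all other
    members are made of segments of [u] and of short spokes from [u] to the apex. *)
Lemma chain_fan i c : i <= N -> size c = 6 -> path (rel_apart (10 * K)) i c ->
  all (leq^~ N) c -> exists A B D P1 P2 M Q1 Q2, @fan G K A B D P1 P2 M Q1 Q2.
Proof.
case: c => [|i1 [|i2 [|i3 [|i4 [|i5 [|i6 [|? ?]]]]]]] //= iN _.
case/and5P=> r01 r12 r23 r34 /and3P[r45 r56 _].
case/and5P=> N1 N2 N3 N4 /and3P[N5 N6 _].
have farv := chain_far N2 r01 r12.
have [y1 [q1 [m1 pr1]]] := ex_projection iN farv.
have [y2 [q2 [m2 pr2]]] := ex_projection N2 farv.
have [y3 [q3 [m3 pr3]]] := ex_projection N4 farv.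
have [y4 [q4 [m4 pr4]]] := ex_projection N6 farv.
have m12 : m1 + 8 * K <= m2.
  have := projection_before iN N1 pr1 r01; have := projection_after N1 N2 pr2 r12; clia.
have m23 : m2 + 8 * K <= m3.
  have := projection_before N2 N3 pr2 r23; have := projection_after N3 N4 pr3 r34; clia.
have m34 : m3 + 8 * K <= m4.
  have := projection_before N4 N5 pr3 r45; have := projection_after N5 N6 pr4 r56; clia.
have m4N : m4 <= N by case: pr4 => _ _ _ [].
have spoke i' y q m : projects i' y q m -> exists X : {set G},
    [/\ conn X, loc K m m X, y \in X & u m \in X].
  case=> _ _ _ [mN ym] _; have [w [pw lw sw]] := ex_geodesic y (u m).
  exists [set z in y :: w]; split; first exact: conn_walk.
  - by apply: loc_walk; rewrite // sw.
  - by rewrite inE mem_head.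
  - by rewrite inE -lw mem_last.
have [X1 [cX1 lX1 yX1 uX1]] := spoke _ _ _ _ pr1.
have [X2 [cX2 lX2 yX2 uX2]] := spoke _ _ _ _ pr2.
have [X3 [cX3 lX3 yX3 uX3]] := spoke _ _ _ _ pr3.
have [X4 [cX4 lX4 yX4 uX4]] := spoke _ _ _ _ pr4.
pose leg q : {set G} := [set z in v :: q].
have v_leg q : v \in leg q by rewrite inE mem_head.
have y_leg i' y q m : projects i' y q m -> y \in leg q.
  by case=> _ <- _ _ _; rewrite inE mem_last.
have conn_leg i' y q m : projects i' y q m -> conn (leg q).
  by case=> pq _ _ _ _; apply: conn_walk.
pose A := leg q1 :|: leg q2 :|: leg q3 :|: leg q4.
have cA : conn A.
  apply: (connU (x := v)); rewrite ?in_setU ?v_leg //;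
    last exact: conn_leg _ _ _ _ pr4.
  apply: (connU (x := v)); rewrite ?in_setU ?v_leg //;
    last exact: conn_leg _ _ _ _ pr3.
  by apply: (connU (x := v)); rewrite ?in_setU ?v_leg //;
    [apply: conn_leg _ _ _ _ pr1|apply: conn_leg _ _ _ _ pr2].
have A_seg lo hi : lo <= hi <= N -> far K A (seg lo hi).
  move=> lh x y p xA /segP[|k kl ->]; first by clia.
  move=> pp lp; apply: leq_trans (dist_walk pp lp).
  have kN : k <= N by clia.
  have leg_far i' y' q m : projects i' y' q m -> x \in leg q -> K <= dist x (u k).
    by case=> _ _ h _ _; rewrite inE => xq; apply: h.
  by move: xA; rewrite !in_setU -!orbA => /or4P[];
    [apply: leg_far pr1|apply: leg_far pr2|apply: leg_far pr3|apply: leg_far pr4].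
have u_seg k lo hi : lo <= k <= hi -> u k \in seg lo hi.
  by move=> lk; apply/segP; [clia|exists k].
have meet (X Y : {set G}) z : z \in X -> z \in Y -> X :&: Y != set0.
  by move=> zX zY; apply/set0Pn; exists z; rewrite inE zX.
have inA z : [|| z \in leg q1, z \in leg q2, z \in leg q3 | z \in leg q4] -> z \in A.
  by rewrite !in_setU -!orbA.
(* The hubs [B] and [D] are segments of radius [3 * K]: a link arriving at the border and the spoke
   at the centre each stray at most [K] from [u], which leaves distance [K] between them. *)
have lP1 : loc K m1 (m2 - 3 * K) (X1 :|: seg m1 (m2 - 3 * K)).
  apply: locU; first by apply: locW lX1; clia.
  by apply: (locW (leq0n K) (leqnn _) (leqnn _)); apply: loc_seg; clia.
have lQ2 : loc K (m3 + 3 * K) m4 (X4 :|: seg (m3 + 3 * K) m4).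
  apply: locU; first by apply: locW lX4; clia.
  by apply: (locW (leq0n K) (leqnn _) (leqnn _)); apply: loc_seg; clia.
have lB : loc 0 (m2 - 3 * K) (m2 + 3 * K) (seg (m2 - 3 * K) (m2 + 3 * K)).
  by apply: loc_seg; clia.
have lD : loc 0 (m3 - 3 * K) (m3 + 3 * K) (seg (m3 - 3 * K) (m3 + 3 * K)).
  by apply: loc_seg; clia.
have lM : loc 0 (m2 + 3 * K) (m3 - 3 * K) (seg (m2 + 3 * K) (m3 - 3 * K)).
  by apply: loc_seg; clia.
exists A, (seg (m2 - 3 * K) (m2 + 3 * K)), (seg (m3 - 3 * K) (m3 + 3 * K)).
exists (X1 :|: seg m1 (m2 - 3 * K)), X2, (seg (m2 + 3 * K) (m3 - 3 * K)), X3.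
exists (X4 :|: seg (m3 + 3 * K) m4).
have seg_conn lo hi : lo <= hi <= N -> conn (seg lo hi) by exact: conn_seg.
split.
- split; split=> //; try (apply: seg_conn; clia).
    by apply: (connU (x := u m1)) => //; [apply: seg_conn|apply: u_seg]; clia.
  by apply: (connU (x := u m4)) => //; [apply: seg_conn|apply: u_seg]; clia.
- split.
  + apply: (meet _ _ y1); last by rewrite in_setU yX1.
    by apply: inA; rewrite (y_leg _ _ _ _ pr1).
  + apply: (meet _ _ y2); last by [].
    by apply: inA; rewrite (y_leg _ _ _ _ pr2) orbT.
  + by apply: (meet _ _ (u (m2 - 3 * K))); rewrite ?in_setU u_seg ?orbT //; clia.
  + by apply: (meet _ _ (u m2)); rewrite // u_seg //; clia.
- split.
  + apply: (meet _ _ y3); last by [].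
    by apply: inA; rewrite (y_leg _ _ _ _ pr3) !orbT.
  + apply: (meet _ _ y4); last by rewrite in_setU yX4.
    by apply: inA; rewrite (y_leg _ _ _ _ pr4) !orbT.
  + by apply: (meet _ _ (u m3)); rewrite // u_seg //; clia.
  + by apply: (meet _ _ (u (m3 + 3 * K))); rewrite ?in_setU u_seg ?orbT //; clia.
- split; [apply: (meet _ _ (u (m2 + 3 * K)))|apply: (meet _ _ (u (m3 - 3 * K)))];
    by rewrite u_seg //; clia.
- by split; [apply: A_seg; clia|apply: A_seg; clia|apply: far_loc lB lD _; clia].
- split; first by apply: A_seg; clia.
  + by apply: far_loc lB lX3 _; clia.
  + by apply: far_loc lB lQ2 _; clia.
  + by apply/far_sym/(far_loc lP1 lD); clia.
  + by apply/far_sym/(far_loc lX2 lD); clia.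
- by split; [apply: far_loc lP1 lX2 _|apply: far_loc lP1 lM _|
    apply: far_loc lP1 lX3 _|apply: far_loc lP1 lQ2 _]; clia.
- by split; [apply: far_loc lX2 lM _|apply: far_loc lX2 lX3 _|
    apply: far_loc lX2 lQ2 _]; clia.
- by split; [apply: far_loc lM lX3 _|apply: far_loc lM lQ2 _|
    apply: far_loc lX3 lQ2 _]; clia.
Qed.

End Geodesic.

Lemma isometric_covered K v x p : 0 < K -> isometric_path x p ->
    (forall A B D P1 P2 M Q1 Q2, ~ @fan G K A B D P1 P2 M Q1 Q2) ->
  covered (nth x (x :: p)) v 0 (size p) (6 * (10 * K)).
Proof.
move=> K0 xp nofan; have sp := isometric_dist xp; case: xp => /and3P[pp _ _] _.
pose u := nth x (x :: p).
have u_edge i : i < size p -> edge (u i) (u i.+1)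
  by move=> ip; move/(pathP x): pp => /(_ _ ip).
have u_le i j : i <= j <= size p -> dist (u i) (u j) <= j - i.
  elim: j => [|j IH] ij.
    have -> : i = 0 by lia.
    by rewrite dist0.
  have [->|Nij] := eqVneq i j.+1; first by rewrite dist0.
  have ij' : i <= j <= size p by lia.
  have := IH ij'; have := dist_edge (u_edge j ltac:(lia)).
  by have := dist_triangle (u j) (u i) (u j.+1); clia.
(* Equality holds for the whole geodesic, so the upper bounds for its three pieces are all
   attained. *)
have u_dist i j : i <= j <= size p -> dist (u i) (u j) = j - i.
  move=> ij; have uN : dist (u 0) (u (size p)) = size p.
    have -> : u (size p) = last x p by rewrite -[RHS](nth_last x (x :: p)).
    exact: esym.
  have le0 := u_le 0 i ltac:(lia); have le1 := u_le j (size p) ltac:(lia).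
  have le2 := u_le i j ij; have := dist_triangle (u i) (u 0) (u (size p)).
  have := dist_triangle (u j) (u i) (u (size p)); clia.
have W0 : 0 < 10 * K by lia.
(* [chain_fan] needs six steps with gap [10 * K]; if there is no such chain, the cover has
   [6 * (10 * K)] paths. *)
have [[c [sc pc Nc]]|//] := chain_or_covered v u_edge u_dist 6 W0 (leq0n (size p)).
have [A [B [D [P1 [P2 [M [Q1 [Q2 F]]]]]]]] :=
  chain_fan u_edge u_dist K0 (leq0n _) sc pc Nc.
by case: (nofan _ _ _ _ _ _ _ _ F).
Qed.
End Metric.

Lemma monoholed_ipc_cover G v : connected_graph G -> monoholed G ->
  ipc_cover v (6 * (10 * 30)) (G := G).
Proof.
move=> [_ cG] mG x p xp.
have [A B D P1 P2 M Q1 Q2|qs [sq iq cq]] := @isometric_covered G cG 30 v x p isT xp.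
  exact: monoholed_no_fan.
exists (fun=> v), (fun i => nth [::] qs i); split=> [i|y yp].
  split; last by left.
  (* Surplus indices yield the default [[::]], the trivial path at [v]. *)
  have [lt|ge] := ltnP i (size qs); first by apply: iq; apply: mem_nth.
  by rewrite nth_default //; apply: dist_isometric => //=; rewrite dist0.
have lty : index y (x :: p) <= size p by rewrite -ltnS index_mem.
have [|q qqs uq] := cq (index y (x :: p)); first by rewrite lty.
have ltq : index q qs < 6 * (10 * 30).
  by apply: leq_trans sq; rewrite index_mem.
by exists (Ordinal ltq); rewrite /= nth_index // -{1}(nth_index x yp).
Qed.

Theorem theorem1p6 :
  asymptotic_minor_free U4 monoholed /\
  exists c : nat, forall (G : sgraph) (Gc : connected_graph G),
    monoholed G -> sipc Gc <= c.
Proof.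
split.
  exists 30; split=> // G mG /U4_fat_minor_fan[A [B [D [P1 [P2 [M [Q1 [Q2]]]]]]]].
  exact: monoholed_no_fan.
exists (6 * (10 * 30)) => G Gc mG; apply/bigmax_leqP => v _.
rewrite /ipc; case: ex_minnP => m _; apply; apply/asboolP.
exact: monoholed_ipc_cover.
Qed.
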